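(* Let $(V,m,b)$ be an infinite weighted directed graph satisfying the standing assumptions (locally finite, weakly connected, $\sum_{y}b(x,y)>0$ for all $x$, and Kirchhoff's assumption), and let $\overline{\Delta}$ be the closure of its Laplacian in $\ell^2(V,m)$. If $\overline{\Delta}$ is m-sectorial with angle $\theta$ and vertex $a$, then $-\overline{\Delta}$ is the generator of a holomorphic semigroup on the sector with angle $\pi/2-\theta$ and vertex $0$, i.e. on $\{z\in\mathbb C\setminus\{0\}: |\arg z|<\pi/2-\theta\}$.
   Context: Graph: $V$ is a countable set, $b:V\times V\to[0,\infty)$ satisfies $b(x,x)=0$ for all $x$, and $m:V\to(0,\infty)$ is a weight on vertices. For $x\in V$, $V_x=\{y\in V: b(x,y)>0\text{ or }b(y,x)>0\}$. Standing assumptions: (1) locally finite: every $V_x$ is finite; (2) weakly connected: any two vertices are joined by a finite chain of undirected edges $\{x,y\}$ (pairs with $b(x,y)>0$ or $b(y,x)>0$); (3) $\sum_{y\in V}b(x,y)>0$ for all $x\in V$; (4) Kirchhoff's assumption: $\sum_{y}b(x,y)=\sum_{y}b(y,x)$ for all $x\in V$. Function spaces: $\mathcal C_c(V)$ is the set of finitely supported functions $V\to\mathbb C$; $\ell^2(V,m)$ is the Hilbert space of $f:V\to\mathbb C$ with $\sum_x m(x)|f(x)|^2<\infty$, with scalar product $\langle f,g\rangle=\sum_x m(x)f(x)\overline{g(x)}$. Laplacian: $\Delta$ is the operator on $\ell^2(V,m)$ with domain $\mathcal C_c(V)$, $\Delta f(x)=\frac{1}{m(x)}\sum_{y\in V}b(x,y)(f(x)-f(y))$.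 It is closable and $\overline{\Delta}$ is its closure. An operator $A$ with domain $D(A)$ is accretive if $\operatorname{Re}\langle Af,f\rangle\ge 0$ for all $f\in D(A)$. An accretive operator $A$ is m-accretive if the open left half-plane is contained in its resolvent set and $\|(A+\lambda)^{-1}\|\le \frac{1}{\operatorname{Re}\lambda}$ for all $\lambda$ with $\operatorname{Re}\lambda>0$. The numerical range of $A$ is $W(A)=\{\langle Af,f\rangle: f\in D(A),\ \|f\|=1\}$. $A$ is m-sectorial with angle $\theta\in[0,\pi/2)$ and vertex $a\in\mathbb R$ if $W(A)\subset S_{a,\theta}:=\{z\in\mathbb C: |\operatorname{Im} z|\le \tan\theta\,(\operatorname{Re} z-a)\text{ and }\operatorname{Re}z\ge a\}$ and $A-a$ is m-accretive. An operator generates a holomorphic semigroup on an open sector $\Sigma$ around the positive real axis with vertex $0$ if it generates a strongly continuous semigroup $(T(t))_{t\ge0}$ that extends to a holomorphic operator-valued map $z\mapsto T(z)$ on $\Sigma$ with $T(z+w)=T(z)T(w)$ and $T(z)\to I$ strongly as $z\to0$ within any strictly smaller closed subsector. *)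

(* Defs.v *)
From HB Require Import structures.
From mathcomp Require Import all_boot all_order all_algebra.
From mathcomp Require Import all_classical all_reals all_analysis.
From mathcomp Require Import ring.
From mathcomp.real_closed Require Import complex.
From mathcomp.analysis.showcase Require summability.

Set Implicit Arguments.
Unset Strict Implicit.
Unset Printing Implicit Defensive.

Import Order.TTheory GRing.Theory Num.Theory numFieldNormedType.Exports.

Local Open Scope classical_set_scope.
Local Open Scope ring_scope.
Local Open Scope complex_scope.

Notation normc := ComplexField.Normc.normc.

(* R[i] has no topology in the libraries; it gets the one of its modulus. *)
HB.instance Definition _ (R : realType) := NormedModule.copy R[i] R[i]^o.

Section l2_space.
Variables (R : realType) (V : countType) (m : V -> {posnum R}).
Implicit Types f g : V -> R[i].

Definition l2_esum f : \bar R :=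
  (\esum_(x in [set: V]) ((m x)%:num * normc (f x) ^+ 2)%:E)%E.

Definition l2_pred : {pred (V -> R[i])} :=
  mem [set f | (l2_esum f < +oo)%E].

Record l2 : Type := L2 { l2_fun :> V -> R[i]; l2P : l2_fun \in l2_pred }.

HB.instance Definition _ := [isSub for l2_fun].
HB.instance Definition _ := [Choice of l2 by <:].

Definition l2_norm f : R := Num.sqrt (fine (l2_esum f)).

Lemma normc_ge0 (z : R[i]) : 0 <= normc z.
Proof. by case: z => a b; exact: sqrtr_ge0. Qed.

Lemma ler_normcD (z w : R[i]) : normc (z + w) <= normc z + normc w.
Proof. by rewrite -lecR rmorphD; exact: ComplexField.lec_normD. Qed.

Lemma term_ge0 f x : (0 <= ((m x)%:num * normc (f x) ^+ 2)%:E)%E.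
Proof. by rewrite lee_fin mulr_ge0// sqr_ge0. Qed.

Lemma l2_esum_ge0 f : (0 <= l2_esum f)%E.
Proof. by apply: esum_ge0 => x _; exact: term_ge0. Qed.

Lemma l2_predP f : reflect (l2_esum f < +oo)%E (f \in l2_pred).
Proof. by apply: (iffP idP); rewrite inE. Qed.

Lemma l2_normK f : f \in l2_pred -> ((l2_norm f ^+ 2)%:E = l2_esum f)%E.
Proof.
move=> /l2_predP fo; rewrite sqr_sqrtr ?fine_ge0 ?l2_esum_ge0//.
by rewrite fineK// ge0_fin_numE ?l2_esum_ge0.
Qed.

Lemma l2_norm_ge0 f : 0 <= l2_norm f. Proof. exact: sqrtr_ge0. Qed.

Lemma l2_le f (s : R) : 0 <= s ->
  (l2_esum f <= (s ^+ 2)%:E)%E -> f \in l2_pred /\ l2_norm f <= s.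
Proof.
move=> s0 fs; have fP : f \in l2_pred.
  by apply/l2_predP; rewrite (le_lt_trans fs) ?ltry.
split=> //; rewrite -(@ler_pXn2r _ 2) ?nnegrE ?l2_norm_ge0//.
by rewrite -lee_fin l2_normK.
Qed.

Lemma l2_pt f x : f \in l2_pred ->
  (m x)%:num * normc (f x) ^+ 2 <= l2_norm f ^+ 2.
Proof.
move=> fP; rewrite -lee_fin l2_normK//.
by apply: esum_ge; exists [set x] => //; rewrite fsbig_set1.
Qed.

Lemma l2_norm_eq0 f : f \in l2_pred -> l2_norm f = 0 -> f = 0.
Proof.
move=> fP f0; apply/funext => x; have := l2_pt x fP.
rewrite f0 expr0n/= pmulr_rle0// => h.
apply: ComplexField.Normc.eq0_normc; apply/eqP.
by rewrite -sqrf_eq0 eq_le h sqr_ge0.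
Qed.

Lemma esumZ (c : R) (a : V -> R) : 0 <= c -> (forall x, 0 <= a x) ->
  (\esum_(x in [set: V]) (c * a x)%:E <=
   c%:E * \esum_(x in [set: V]) (a x)%:E)%E.
Proof.
move=> c0 a0; apply: ge_ereal_sup => _ [A [finA _] <-].
under eq_fsbigr do rewrite EFinM.
rewrite -ge0_mule_fsumr; last by move=> x; rewrite lee_fin.
by rewrite lee_wpmul2l ?lee_fin//; apply: esum_ge; exists A.
Qed.

Lemma l2D f g : f \in l2_pred -> g \in l2_pred ->
  f + g \in l2_pred /\ l2_norm (f + g) <= l2_norm f + l2_norm g.
Proof.
move=> fP gP.
have [/l2_norm_eq0 ->//|fn0] := eqVneq (l2_norm f) 0.
  by rewrite add0r lerDr l2_norm_ge0.
have [/l2_norm_eq0 ->//|gn0] := eqVneq (l2_norm g) 0.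
  by rewrite addr0 lerDl l2_norm_ge0.
set s := l2_norm f; set t := l2_norm g.
have s0 : 0 < s by rewrite lt_def fn0 l2_norm_ge0.
have t0 : 0 < t by rewrite lt_def gn0 l2_norm_ge0.
apply: l2_le; first by rewrite addr_ge0// ltW.
pose c := 1 + t / s; pose d := 1 + s / t.
have c0 : 0 <= c by rewrite addr_ge0// divr_ge0// ltW.
have d0 : 0 <= d by rewrite addr_ge0// divr_ge0// ltW.
pose a x := (m x)%:num * normc (f x) ^+ 2.
pose b x := (m x)%:num * normc (g x) ^+ 2.
have a0 x : 0 <= a x by rewrite mulr_ge0// sqr_ge0.
have b0 x : 0 <= b x by rewrite mulr_ge0// sqr_ge0.
apply: (@le_trans _ _
    (\esum_(x in [set: V]) ((c * a x)%:E + (d * b x)%:E))%E).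
  apply: le_esum => x _; rewrite -EFinD lee_fin.
  rewrite /a /b (mulrCA c) (mulrCA d) -mulrDr ler_wpM2l//.
  apply: (@le_trans _ _ ((normc (f x) + normc (g x)) ^+ 2)).
    rewrite ler_pXn2r ?nnegrE ?normc_ge0 ?ler_normcD//.
    by rewrite addr_ge0 ?normc_ge0.
  set u := normc (f x); set v := normc (g x).
  rewrite -subr_ge0.
  have -> : c * u ^+ 2 + d * v ^+ 2 - (u + v) ^+ 2 = (t * u - s * v) ^+ 2 / (s * t).
    by rewrite /c /d; field; rewrite fn0 gn0.
  by rewrite divr_ge0 ?sqr_ge0// mulr_ge0// ltW.
rewrite esumD; [|by move=> x _; rewrite lee_fin mulr_ge0..].
apply: le_trans (leeD (esumZ c0 a0) (esumZ d0 b0)) _.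
rewrite -/(l2_esum f) -/(l2_esum g) -!l2_normK// -!EFinM -EFinD lee_fin.
rewrite -/s -/t /c /d !mulrDl !mul1r.
have -> : t / s * s ^+ 2 = t * s by rewrite expr2 mulrA divfK.
have -> : s / t * t ^+ 2 = s * t by rewrite expr2 mulrA divfK.
by rewrite le_eqVlt; apply/orP; left; apply/eqP; ring.
Qed.

Lemma l2Z (c : R[i]) f : f \in l2_pred ->
  c *: f \in l2_pred /\ l2_norm (c *: f) <= normc c * l2_norm f.
Proof.
move=> fP; apply: l2_le; first by rewrite mulr_ge0 ?normc_ge0 ?l2_norm_ge0.
rewrite exprMn EFinM l2_normK//.
apply: le_trans (esumZ (sqr_ge0 _) _); last first.
  by move=> x; rewrite mulr_ge0// sqr_ge0.
apply: le_esum => x _; rewrite lee_fin.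
by rewrite /= ComplexField.Normc.normcM exprMn mulrCA.
Qed.

Lemma l2_submod_closed : submod_closed l2_pred.
Proof.
split=> [|c f g fP gP].
  have := @l2_le 0 0 (lexx 0); case => //.
  rewrite /l2_esum esum1 ?expr0n// => x _.
  have -> : normc ((0 : V -> R[i]) x) = 0 by exact: ComplexField.Normc.normc0.
  by rewrite expr0n/= mulr0.
by have [cfP _] := l2Z c fP; have [] := l2D cfP gP.
Qed.

HB.instance Definition _ :=
  GRing.isSubmodClosed.Build _ _ l2_pred l2_submod_closed.
HB.instance Definition _ := [SubChoice_isSubLmodule of l2 by <:].

Let nrm (f : l2) : R[i] := (l2_norm f)%:C.

Lemma l2_ler_normD (f g : l2) : nrm (f + g) <= nrm f + nrm g.
Proof. by rewrite -rmorphD lecR; have [] := l2D (l2P f) (l2P g). Qed.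

Lemma l2_normrZ (c : R[i]) (f : l2) : nrm (c *: f) = `|c| * nrm f.
Proof.
have le (d : R[i]) (h : l2) : l2_norm (d *: h) <= normc d * l2_norm h.
  by have [] := l2Z d (l2P h).
rewrite -[`|c|]/((normc c)%:C) -rmorphM; congr (_%:C).
apply/eqP; rewrite eq_le le/=.
have [->|c0] := eqVneq c 0.
  rewrite (ComplexField.Normc.normc0 R : normc 0 = 0) mul0r.
  exact: l2_norm_ge0.
have nc0 : 0 < normc c.
  rewrite lt_def normc_ge0 andbT; apply: contra c0 => /eqP.
  by move/ComplexField.Normc.eq0_normc ->.
rewrite -ler_pdivlMl//.
have := le c^-1 (c *: f).
by rewrite scalerA mulVf// scale1r ComplexField.Normc.normcV.
Qed.

Lemma l2_normr0_eq0 (f : l2) : nrm f = 0 -> f = 0.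
Proof. by move=> /complexI f0; apply/val_inj/(l2_norm_eq0 (l2P f) f0). Qed.

(* The norm of a normed R[i]-module is R[i]-valued: `|f| = (l2_norm f)%:C. *)
HB.instance Definition _ :=
  Lmodule_isNormed.Build R[i] l2 l2_ler_normD l2_normrZ l2_normr0_eq0.

(* Unordered sum: the limit of the partial sums along the finite sets of
   vertices directed by inclusion. *)
Definition l2_dot (f g : l2) : R[i] :=
  summability.sum (fun x => ((m x)%:num)%:C * (f x * (g x)^*)).

End l2_space.

(* An unbounded operator A in H is represented by its graph, a subset of
   H * H: A (f, g) reads "f is in D(A) and A f = g". *)
Section operators.
Variables (R : realType) (H : normedModType R[i]).
Implicit Types (A : set (H * H)) (B : {linear H -> H}) (l : R[i]).

Definition op_addC A l : set (H * H) := [set (p.1, p.2 + l *: p.1) | p in A].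

Definition op_opp A : set (H * H) := [set (p.1, - p.2) | p in A].

Definition op_inverse A B :=
  (forall g, A (B g, g)) /\ (forall f g, A (f, g) -> B g = f).

Definition resolvent_set A : set R[i] :=
  [set l | exists B, continuous B /\ op_inverse (op_addC A (- l)) B].

Record c0_semigroup (T : R -> {linear H -> H}) : Prop := {
  c0_bounded : forall t, 0 <= t -> continuous (T t) ;
  c0_0 : forall f, T 0 f = f ;
  c0_D : forall s t f, 0 <= s -> 0 <= t -> T (s + t) f = T s (T t f) ;
  c0_strong : forall f, {within [set t | 0 <= t], continuous (T ^~ f)} }.

Definition semigroup_generator (T : R -> {linear H -> H}) : set (H * H) :=
  [set p | (t^-1)%:C *: (T t p.1 - p.1) @[t --> 0^'+] --> p.2].

(* Complex differentiability in the operator norm: ||B|| <= e is spelled out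
   as |B f| <= e |f| for all f. *)
Definition holomorphic_on (S : set R[i]) (T : R[i] -> {linear H -> H}) :=
  forall z, S z -> exists B, continuous B /\
    forall e : R, 0 < e -> \forall w \near (0 : R[i])^',
      forall f, `|w^-1 *: (T (z + w) f - T z f) - B f| <= e%:C * `|f|.

End operators.

Section sectors.
Variable R : realType.

Definition Arg (z : R[i]) : R :=
  xget 0 [set t | - pi < t <= pi /\ z = (normc z)%:C * (cos t +i* sin t)].

Definition open_sector (phi : R) : set R[i] :=
  [set z | z != 0 /\ `|Arg z| < phi].

Definition closed_sector (psi : R) : set R[i] :=
  [set z | z != 0 /\ `|Arg z| <= psi].

Lemma ArgP (z : R[i]) : z != 0 ->
  - pi < Arg z <= pi /\ z = (normc z)%:C * (cos (Arg z) +i* sin (Arg z)).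
Proof.
case: z => x y z0; rewrite /Arg; case: xgetP => [t -> //|] /=.
set r := Num.sqrt _ => nArg; exfalso.
have r0 : 0 < r.
  rewrite sqrtr_gt0 lt_def addr_ge0 ?sqr_ge0// andbT.
  by rewrite paddr_eq0 ?sqr_ge0// !sqrf_eq0 -(eq_complex (x +i* y) 0).
have r2 : r ^+ 2 = x ^+ 2 + y ^+ 2 by rewrite sqr_sqrtr// addr_ge0 ?sqr_ge0.
have xr : -1 <= x / r <= 1.
  rewrite -ler_norml normrM normfV (gtr0_norm r0) ler_pdivrMr// mul1r.
  by rewrite -(@ler_pXn2r _ 2) ?nnegrE ?(ltW r0)// real_normK ?num_real// r2 lerDl sqr_ge0.
have cx : r * cos (acos (x / r)) = x.
  by rewrite acosK ?in_itv//= mulrCA divff ?mulr1 ?gt_eqF.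
have sy : r * sin (acos (x / r)) = `|y|.
  rewrite sin_acos// -{1}(gtr0_norm r0) -sqrtr_sqr -sqrtrM ?sqr_ge0//.
  rewrite mulrBr mulr1 exprMn exprVn mulrCA divff ?mulr1 ?sqrf_eq0 ?gt_eqF//.
  by rewrite r2 addrC addKr sqrtr_sqr.
have pi0 := pi_gt0 R.
have [y0|y0] := leP 0 y.
  apply: (nArg (acos (x / r))); split.
    rewrite (lt_le_trans _ (acos_ge0 xr)) ?oppr_lt0//=.
    exact: acos_lepi.
  by simpc; rewrite cx sy ger0_norm.
apply: (nArg (- acos (x / r))); split; last first.
  by simpc; rewrite cosN sinN mulrN cx sy ltr0_norm// opprK.
rewrite ltrN2 (le_trans _ (ltW pi0)) ?oppr_le0 ?acos_ge0// andbT.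
rewrite lt_def acos_lepi// andbT; apply/eqP => h.
by move: sy; rewrite -h sinpi mulr0 => /esym/normr0P; rewrite lt_eqF.
Qed.

End sectors.

Section holomorphic_semigroups.
Variables (R : realType) (H : normedModType R[i]).

(* Z is the holomorphic extension, to the open sector of half-angle phi around
   the positive real axis, of the semigroup T on [0, +oo[. *)
Definition generates_holomorphic_semigroup (A : set (H * H)) (phi : R) :=
  exists (T : R -> {linear H -> H}) (Z : R[i] -> {linear H -> H}),
    [/\ c0_semigroup T, semigroup_generator T = A,
        forall t, 0 < t -> Z t%:C =1 T t,
        forall z, open_sector phi z -> continuous (Z z) &
     [/\ holomorphic_on (open_sector phi) Z,
         forall z w f, open_sector phi z -> open_sector phi w ->
           Z (z + w) f = Z z (Z w f) &
         forall psi f, 0 <= psi < phi ->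
           Z z f @[z --> within (closed_sector psi) (nbhs (0 : R[i]))] --> f]].

End holomorphic_semigroups.

Section sectorial_operators.
Variables (R : realType) (V : countType) (m : V -> {posnum R}).
Implicit Types A : set (l2 m * l2 m).

Definition accretive A := forall f g, A (f, g) -> 0 <= complex.Re (l2_dot g f).

Definition m_accretive A :=
  [/\ accretive A,
      [set l | complex.Re l < 0] `<=` resolvent_set A &
      forall l (B : {linear l2 m -> l2 m}), 0 < complex.Re l ->
        op_inverse (op_addC A l) B ->
        forall f, `|B f| <= ((complex.Re l)^-1)%:C * `|f|].

Definition numerical_range A : set R[i] :=
  [set l2_dot p.2 p.1 | p in [set p | A p /\ `|p.1| = 1]].

Definition sector_region (a theta : R) : set R[i] :=
  [set z | `|complex.Im z| <= tan theta * (complex.Re z - a) /\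
           a <= complex.Re z].

Definition m_sectorial A (theta a : R) :=
  numerical_range A `<=` sector_region a theta /\
  m_accretive (op_addC A (- a%:C)).

End sectorial_operators.

Section graphs.
Variables (R : realType) (V : countType) (m : V -> {posnum R}).
Variable b : V -> V -> R.

Definition edge : rel V := fun x y => (0 < b x y) || (0 < b y x).

Definition locally_finite := forall x, finite_set [set y | edge x y].

Definition weakly_connected :=
  forall x y, exists p : seq V, path edge x p /\ last x p = y.

(* The sums over V of this section have finitely many nonzero terms as soon
   as the graph is locally finite. *)
Definition kirchhoff := forall x,
  \sum_(y \in [set: V]) b x y = \sum_(y \in [set: V]) b y x.

Definition laplacian_fun (f : V -> R[i]) (x : V) : R[i] :=
  ((m x)%:num^-1)%:C * \sum_(y \in [set: V]) (b x y)%:C * (f x - f y).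

Definition laplacian : set (l2 m * l2 m) :=
  [set p : l2 m * l2 m | finite_set [set x | p.1 x != 0] /\
           forall x, p.2 x = laplacian_fun p.1 x].

(* The domain is the whole of C_c(V): Delta maps C_c(V) into l2. *)
Lemma laplacian_dom : (forall x y, 0 <= b x y) -> locally_finite ->
  forall f : V -> R[i], finite_set [set x | f x != 0] ->
  exists u v : l2 m, l2_fun u = f /\ laplacian (u, v).
Proof.
have Cc_l2 (g : V -> R[i]) : finite_set [set x | g x != 0] -> g \in l2_pred m.
  move=> fg; apply/l2_predP.
  have -> : l2_esum m g =
      (\esum_(x in [set x | (g x != 0)%R]) ((m x)%:num * normc (g x) ^+ 2)%:E)%E.
    rewrite [RHS]esum_mkcond; apply: eq_esum => x _ /=; case: ifPn => //.
    rewrite notin_setE /= => /negP; rewrite negbK => /eqP ->.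
    by rewrite (ComplexField.Normc.normc0 R : normc 0 = 0) expr0n/= mulr0.
  rewrite esum_fset//=; first by rewrite fsumEFin// ltry.
  by move=> x _; exact: term_ge0.
move=> b0 lf f ff.
have fL : finite_set [set x | laplacian_fun f x != 0].
  apply: (@sub_finite_set _ _ ([set x | f x != 0] `|`
      \bigcup_(y in [set y | f y != 0]) [set x | edge y x])).
    move=> x /= Lx; apply: contrapT => /not_orP[/= /negP]; rewrite negbK.
    move=> /eqP fx0 nadj; move: Lx; rewrite /laplacian_fun fsbig1 ?mulr0 ?eqxx//.
    move=> y _; rewrite fx0 sub0r.
    have [->|fy0] := eqVneq (f y) 0; first by rewrite oppr0 mulr0.
    have [->|bxy] := eqVneq (b x y) 0; first by rewrite mul0r.
    exfalso; apply: nadj; exists y => //=.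
    by rewrite /edge (lt_def _ (b x y)) bxy b0 orbT.
  by rewrite finite_setU; split=> //; apply: bigcup_finite => // y _; exact: lf.
by exists (L2 (Cc_l2 _ ff)), (L2 (Cc_l2 _ fL)).
Qed.

Lemma l2_eval_continuous x : continuous (fun f : l2 m => f x).
Proof.
move=> f; apply/(@cvgrPdist_lt _ _ _ (nbhs f)) => /= e e0.
have s0 : 0 < Num.sqrt (m x)%:num by rewrite sqrtr_gt0.
have s0' : 0 < (Num.sqrt (m x)%:num)%:C :> R[i] by rewrite ltcR.
have es : 0 < (Num.sqrt (m x)%:num)%:C * e by rewrite mulr_gt0.
near=> g.
have h : `|f - g| < (Num.sqrt (m x)%:num)%:C * e by near: g; exact: cvgr_dist_lt.
rewrite -(ltr_pM2l s0'); apply: le_lt_trans h.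
have := l2_pt x (l2P (f - g)).
rewrite -{1}(sqr_sqrtr (ltW (gt0 (m x)))) -exprMn.
rewrite ler_pXn2r ?nnegrE ?l2_norm_ge0 ?mulr_ge0 ?normc_ge0 ?sqrtr_ge0//.
by rewrite -lecR rmorphM.
Unshelve. all: by end_near. Qed.

(* Closability: the closure of the graph is again single-valued. *)
Lemma closure_laplacian : (forall x y, 0 <= b x y) -> locally_finite ->
  closure laplacian `<=`
  [set p : l2 m * l2 m | forall x, p.2 x = laplacian_fun p.1 x].
Proof.
move=> b0 lf p clp x.
pose D (q : l2 m * l2 m) : R[i] := q.2 x - laplacian_fun q.1 x.
suff Dc : continuous D.
  have cD : closed (D @^-1` [set 0]).
    apply: preimage_closed; first by move=> q _; exact: Dc.
    exact/accessible_closed_set1/hausdorff_accessible/norm_hausdorff.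
  apply/eqP; rewrite -subr_eq0; apply/eqP.
  apply: (cD p); apply: closureS clp => q [_ qE].
  by rewrite /D /= qE subrr.
have ev1 y : continuous (fun q : l2 m * l2 m => q.1 y).
  move=> q; apply: (@continuous_comp _ _ _ fst (fun f : l2 m => f y)).
    exact: cvg_fst.
  exact: l2_eval_continuous.
have ev2 y : continuous (fun q : l2 m * l2 m => q.2 y).
  move=> q; apply: (@continuous_comp _ _ _ snd (fun f : l2 m => f y)).
    exact: cvg_snd.
  exact: l2_eval_continuous.
have L1 : continuous (fun r : l2 m * l2 m => laplacian_fun r.1 x).
  rewrite (_ : (fun _ => _) = fun r : l2 m * l2 m => ((m x)%:num^-1)%:C *
     \sum_(y <- finmap.enum_fset (fset_set [set y | edge x y]))
        (b x y)%:C * (r.1 x - r.1 y)).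
    move=> q; apply: cvgMl_tmp.
    apply: cvg_big => [|y _]; first exact: add_continuous.
    by apply: cvgMl_tmp; apply: cvgB; exact: ev1.
  apply/funext => r; rewrite /laplacian_fun -fsbig_finite//; congr (_ * _).
  apply/esym/fsbig_widen => // y [_ /= nadj].
  rewrite (_ : b x y = 0) ?mul0r//; apply/eqP; rewrite eq_le b0 andbT leNgt.
  by apply/negP => bxy; apply: nadj; rewrite /edge bxy.
by move=> q; apply: cvgB; [exact: ev2|exact: L1].
Qed.
End graphs.

Arguments laplacian {R V} m b.

(* Main.v *)
Require Import Defs.
From HB Require Import structures.
From mathcomp Require Import all_boot all_order all_algebra finmap.
From mathcomp Require Import all_classical all_reals all_analysis.
From mathcomp Require Import ring lra.
From mathcomp.real_closed Require Import complex.
From mathcomp.analysis.showcase Require Import summability.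

Import Order.TTheory GRing.Theory Num.Theory numFieldNormedType.Exports.

Local Open Scope classical_set_scope.
Local Open Scope ring_scope.
Local Open Scope complex_scope.

(** Write B for the operator A - a, where A is the closure of the Laplacian.
    Sectoriality says that Re (z <B f, f>) is nonnegative on the sector S of
    half-angle pi/2 - theta, so for z in S the resolvent J z = (1 + z B)^-1 is
    a contraction ([sectorial_resolvents]); m-accretivity provides it on the
    whole space.  The semigroup of - B is built on all of S at once, without
    contour integrals, as the limit of the backward Euler scheme
    T z = lim (J (z / n))^n along n = 2^k.  Since
      J a (J b) - J (a + b) = - a b J a (J b) (J (a + b)) B^2,
    telescoping commuting contractions gives convergence and the semigroup law
    on the dense domain of B^2 ([euler_mul_le], [euler_cvg], [sg_mul]), and
    [strong_limit] extends both to the whole space.  The same algebra gives the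
    Taylor bound |T (z + v) f - T z f + v T z (B f)| <= |v|^2 |B^2 f|
    ([sg_taylor]), hence strong continuity and the generator.

    Holomorphy in operator norm requires the smoothing bound |T z B f| <= c |f|
    for z in S ([sectorial_smoothing]).  It follows from an energy argument for
    the scheme itself.  With P = z B, u_k = J^k f, v_k = P u_k and step h, the
    quantity (k + 1)^2 h^2 |v_k|^2 + M^2 |u_k|^2 does not increase
    ([euler_step_energy]): a step dissipates Re <P u, u> and Re <P v, v>, and
    these control |v|^2 = Re <P u, v> by a Cauchy-Schwarz inequality for
    sectorial forms ([sectorial_cauchy_schwarz]), whose constant depends on the
    distance from z to the boundary of S.  Therefore T z maps into the domain
    of B, T (z / 2) = T (z / 4) T (z / 4) maps boundedly into the domain of
    B^2, and the Taylor bound applied to T (z + v) = T (z / 2 + v) T (z / 2)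
    becomes a second-order bound in operator norm ([sg_differentiable]).

    Finally exp (- a z) T z is the semigroup of - A.  On the concrete space one
    needs that l2 is complete ([l2_complete]), that finitely supported
    functions are dense ([finite_support_dense]) and that the scalar product,
    an unordered sum, is an inner product inducing the norm
    ([l2_inner_product]). *)

Set Implicit Arguments.
Unset Strict Implicit.
Unset Printing Implicit Defensive.

(** * Real-valued norms and strong limits *)

Section real_norm.
Variables (R : realType) (H : normedModType R[i]).
Implicit Types (f g : H) (z : R[i]) (e : R).

(** The norm of a normed module over R[i] takes its values in R[i]; its real
    part makes the estimates available to real arithmetic. *)
Definition nm f : R := complex.Re `|f|.

Lemma nmE f : `|f| = (nm f)%:C.
Proof. by rewrite /nm RRe_real. Qed.

Lemma nm_ge0 f : 0 <= nm f.
Proof. by rewrite -lecR -nmE normr_ge0. Qed.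

Lemma nm0 : nm 0 = 0. Proof. by rewrite /nm normr0. Qed.

Lemma nmD f g : nm (f + g) <= nm f + nm g.
Proof. by have := ler_normD f g; rewrite !nmE -rmorphD lecR. Qed.

Lemma nmN f : nm (- f) = nm f. Proof. by rewrite /nm normrN. Qed.

Lemma nm_distC f g : nm (f - g) = nm (g - f).
Proof. by rewrite -nmN opprB. Qed.

Lemma nmB f g : nm (f - g) <= nm f + nm g.
Proof. by rewrite -(nmN g) nmD. Qed.

Lemma nm_triangle f g h : nm (f - h) <= nm (f - g) + nm (g - h).
Proof. by rewrite -(subrKA g) nmD. Qed.

Lemma nmZ z f : nm (z *: f) = normc z * nm f.
Proof. by apply: complexI; rewrite -nmE normrZ nmE rmorphM. Qed.

Lemma nmZR (t : R) f : nm (t%:C *: f) = `|t| * nm f.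
Proof. by rewrite nmZ /= expr0n/= addr0 sqrtr_sqr. Qed.

Lemma nm_eq0 f : nm f = 0 -> f = 0.
Proof. by move=> f0; apply/normr0_eq0; rewrite nmE f0. Qed.

Lemma cvg_nmP (T : Type) (F : set_system T) {FF : Filter F} (u : T -> H) l :
  u x @[x --> F] --> l <->
  forall e, 0 < e -> \forall x \near F, nm (l - u x) <= e.
Proof.
rewrite (cvgrPdist_le u l); split=> h e e0.
  by near do rewrite -lecR -nmE; apply: h; rewrite ltcR.
have eE : e = (complex.Re e)%:C by rewrite RRe_real// gtr0_real.
rewrite eE; near do rewrite nmE lecR; apply: h.
by rewrite -ltcR -eE.
Unshelve. all: by end_near. Qed.

Lemma cvg_nm_le (u : nat -> H) (v : nat -> R) l c :
  u @ \oo --> l -> v @ \oo --> c -> (forall k, nm (u k) <= v k) -> nm l <= c.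
Proof.
move=> /cvg_nmP ul /cvgrPdist_le vc uv; apply/ler_addgt0Pr => e e0.
have e20 : 0 < e / 2 by rewrite divr_gt0.
near \oo => k.
have h1 : nm (l - u k) <= e / 2 by near: k; exact: ul.
have h2 : `|c - v k| <= e / 2 by near: k; exact: vc.
have := nmD (l - u k) (u k); rewrite subrK; have := uv k.
by move: h2; rewrite ler_norml => /andP[]; lra.
Unshelve. all: by end_near. Qed.

Lemma cvg_nm_squeeze (T : Type) (F : set_system T) {FF : Filter F}
    (u : T -> H) (v : T -> R) l :
  v x @[x --> F] --> 0 -> (\forall x \near F, nm (u x - l) <= v x) ->
  u x @[x --> F] --> l.
Proof.
move=> /cvgrPdist_le v0 uv; apply/cvg_nmP => e e0.
near=> x; rewrite nm_distC.
have h : nm (u x - l) <= v x by near: x.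
apply: le_trans h _; rewrite (le_trans (ler_norm _))//.
by rewrite -normrN -sub0r; near: x; exact: v0.
Unshelve. all: by end_near. Qed.

Lemma bounded_continuous (L : {linear H -> H}) c :
  (forall f, nm (L f) <= c * nm f) -> continuous L.
Proof.
move=> Lc f; apply/(@cvg_nmP _ (nbhs f)) => e e0.
have c0 : 0 < `|c| + 1 by rewrite ltr_wpDl.
have /(@cvg_nmP _ (nbhs f))/(_ (e / (`|c| + 1))) : g @[g --> f] --> f by [].
rewrite divr_gt0// => /(_ isT); apply: filterS => g; rewrite ler_pdivlMr// => h.
rewrite -linearB (le_trans (Lc _))// (le_trans _ h)// mulrC.
by rewrite ler_wpM2l ?nm_ge0// (le_trans (ler_norm _))// lerDl.
Qed.

Definition cauchy_complete := forall u : nat -> H,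
  (forall e, 0 < e -> exists N, forall i j, (N <= i)%N -> (N <= j)%N ->
     nm (u i - u j) <= e) -> cvg (u @ \oo).

Definition dense_set (D : set H) :=
  forall f e, 0 < e -> exists2 g, D g & nm (f - g) <= e.

Lemma linear_pack (F : H -> H) : linear F ->
  exists L : {linear H -> H}, forall f, L f = F f.
Proof.
move=> linF.
pose isL := GRing.isLinear.Build _ _ _ _ F linF.
pose L : {linear H -> H} := HB.pack F isL.
by exists L.
Qed.

(** Uniformly bounded operators that converge on a dense set converge strongly:
    the three-epsilon argument, followed by completeness. *)
Lemma strong_limit (S : nat -> H -> H) c (D : set H) : cauchy_complete ->
  (forall k, linear (S k)) -> (forall k f, nm (S k f) <= c * nm f) ->
  dense_set D -> (forall g, D g -> cvg (S k g @[k --> \oo])) ->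
  exists L : {linear H -> H},
    (forall f, nm (L f) <= c * nm f) /\ forall f, S k f @[k --> \oo] --> L f.
Proof.
move=> Hc Slin Sc Dd SD.
have SB k f g : S k (f - g) = S k f - S k g.
  by have := Slin k (- 1) g f; rewrite !scaleN1r !(addrC (- _)).
have cvgS f : cvg (S k f @[k --> \oo]).
  apply: Hc => e e0.
  have c0 : 0 < `|c| + 1 by rewrite ltr_wpDl.
  have d0 : 0 < e / 4 / (`|c| + 1) by rewrite !divr_gt0.
  have [g Dg fg] := Dd f _ d0.
  have Sfg k : nm (S k f - S k g) <= e / 4.
    rewrite -SB (le_trans (Sc _ _))//; move: fg; rewrite ler_pdivlMr// => fg.
    apply: le_trans fg; rewrite mulrC ler_wpM2l ?nm_ge0//.
    by rewrite (le_trans (ler_norm _))// lerDl.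
  have /cvg_nmP/(_ (e / 4)) := SD _ Dg.
  rewrite divr_gt0// => /(_ isT)[N _ hN]; exists N => i j Ni Nj.
  have := hN _ Ni; have := hN _ Nj; have := Sfg i; have := Sfg j => /=.
  set l := lim _ => a1 a2 a3 a4.
  have := nm_triangle (S i f) (S i g) (S j f).
  have := nm_triangle (S i g) l (S j f).
  have := nm_triangle l (S j g) (S j f).
  rewrite (nm_distC (S i g) l) (nm_distC (S j g) (S j f)); lra.
pose F f := lim (S k f @[k --> \oo]).
have linF : linear F.
  move=> a f g; apply/cvg_lim; first exact: norm_hausdorff.
  rewrite (_ : (fun k => _) = (fun k => a *: S k f + S k g)); last first.
    by apply/funext => k; rewrite Slin.
  by apply: cvgD; [apply: cvgZl_tmp|]; exact: cvgS.
have [L LE] := linear_pack linF; exists L; split=> f; last first.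
  by rewrite LE; exact: cvgS.
rewrite LE; apply: (@cvg_nm_le (fun k => S k f) (fun=> c * nm f)) => //.
exact: cvg_cst.
Qed.

End real_norm.

(** * Powers of commuting contractions *)

Section iterates.
Variables (R : realType) (H : normedModType R[i]).
Implicit Types (f g : H) (P Q : {linear H -> H}).

Lemma iter_linear P n : linear (iter n P).
Proof. by move=> c f g; elim: n => //= n ->; rewrite linearP. Qed.

Lemma iter_addv P n f g : iter n P (f + g) = iter n P f + iter n P g.
Proof. by rewrite -[f]scale1r iter_linear !scale1r. Qed.

Lemma iter_scale P n c f : iter n P (c *: f) = c *: iter n P f.
Proof.
have P0 : iter n P 0 = 0 by elim: n => //= n ->; rewrite linear0.
by rewrite -[c *: f]addr0 iter_linear P0 addr0.
Qed.

Lemma iter_sub P n f g : iter n P (f - g) = iter n P f - iter n P g.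
Proof. by rewrite -scaleN1r iter_addv iter_scale scaleN1r. Qed.

Lemma iter_comm P Q n f : (forall g, P (Q g) = Q (P g)) ->
  P (iter n Q f) = iter n Q (P f).
Proof. by move=> PQ; elim: n => //= n <-. Qed.

Lemma iter_contr P n f : (forall g, nm (P g) <= nm g) ->
  nm (iter n P f) <= nm f.
Proof. by move=> Pc; elim: n => //= n; apply: le_trans. Qed.

Lemma iter_mul P Q n f : (forall g, P (Q g) = Q (P g)) ->
  iter n P (iter n Q f) = iter n (P \o Q) f.
Proof.
move=> PQ; elim: n => //= n IHn.
by rewrite -[in RHS]IHn -(iter_comm n _ (fun g => esym (PQ g))).
Qed.

(** Telescoping: P^n - Q^n is a sum of n terms P^i (P - Q) Q^(n - 1 - i), each
    of which is bounded by P - Q. *)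
Lemma iter_sub_le P Q n f : (forall g, P (Q g) = Q (P g)) ->
  (forall g, nm (P g) <= nm g) -> (forall g, nm (Q g) <= nm g) ->
  nm (iter n P f - iter n Q f) <= n%:R * nm (P f - Q f).
Proof.
move=> PQ Pc Qc; elim: n => [|n IHn]; first by rewrite subrr nm0 mul0r.
have -> : iter n.+1 P f - iter n.+1 Q f =
    iter n P (P f - Q f) + Q (iter n P f - iter n Q f).
  rewrite iter_sub linearB -iterSr /= (iter_comm n f (fun g => esym (PQ g))).
  by rewrite addrA subrK.
rewrite (le_trans (nmD _ _))// -natr1 mulrDl mul1r addrC.
by rewrite lerD ?iter_contr// (le_trans (Qc _)).
Qed.

End iterates.

(** * Calculus of resolvents *)

Section resolvents.
Variables (R : realType) (H : normedModType R[i]).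

(** J z is the resolvent (1 + z B)^-1.  At z = 0 it is the identity, whose range
    need not lie in the domain of B; whence the separate field and the
    restriction of [res_dom] to nonzero z. *)
Record contractive_resolvents (B : set (H * H)) (K : set R[i])
    (J : R[i] -> {linear H -> H}) : Prop := {
  res_lin : forall c f y g w, B (f, y) -> B (g, w) ->
    B (c *: f + g, c *: y + w) ;
  res_zero : forall f, J 0 f = f ;
  res_dom : forall z g, K z -> z != 0 ->
    exists y, B (J z g, y) /\ J z g + z *: y = g ;
  res_inv : forall z f y, K z -> B (f, y) -> J z (f + z *: y) = f ;
  res_contr : forall z f, K z -> nm (J z f) <= nm f }.

Variables (B : set (H * H)) (K : set R[i]) (J : R[i] -> {linear H -> H}).
Hypothesis BJ : contractive_resolvents B K J.
Implicit Types (f g y w : H) (a b z : R[i]).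

Lemma graphD f y g w : B (f, y) -> B (g, w) -> B (f + g, y + w).
Proof. by move=> h1 h2; have := res_lin BJ 1 h1 h2; rewrite !scale1r. Qed.

Lemma graphB f y g w : B (f, y) -> B (g, w) -> B (f - g, y - w).
Proof.
move=> h1 h2; have := res_lin BJ (- 1) h2 h1.
by rewrite !scaleN1r !(addrC (- _)).
Qed.

Lemma graphZ c f y : B (f, y) -> B (c *: f, c *: y).
Proof.
move=> h; have := res_lin BJ c h (graphB h h).
by rewrite !subrr !addr0.
Qed.

Lemma res_sub z f y : K z -> B (f, y) -> J z f - f = - (z *: J z y).
Proof.
move=> Kz fy; have := res_inv BJ Kz fy.
by rewrite linearD linearZ => {2}<-; rewrite opprD addrA subrr sub0r.
Qed.

Lemma res_graph z f y : K z -> B (f, y) -> B (J z f, J z y).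
Proof.
have [->|z0] := eqVneq z 0; first by rewrite !(res_zero BJ).
move=> Kz fy; have [y' [fy' e]] := res_dom BJ f Kz z0.
rewrite (_ : J z y = y')//; apply: (scalerI z0).
have := res_sub Kz fy; rewrite -{2}e opprD addrA subrr sub0r => /oppr_inj.
by move=> ->.
Qed.

Lemma res_comm a b f : K a -> K b -> J a (J b f) = J b (J a f).
Proof.
move=> Ka Kb; have [->|b0] := eqVneq b 0; first by rewrite !(res_zero BJ).
have [y [fy e]] := res_dom BJ f Kb b0.
by rewrite -{2}e linearD linearZ (res_inv BJ Kb)//; exact: res_graph.
Qed.

Lemma res_iter_contr a n f : K a -> nm (iter n (J a) f) <= nm f.
Proof. by move=> Ka; apply: iter_contr => g; exact: (res_contr BJ). Qed.

Lemma res_iter_graph a n f y : K a -> B (f, y) ->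
  B (iter n (J a) f, iter n (J a) y).
Proof. by move=> Ka fy; elim: n => //= n; exact: res_graph. Qed.

Lemma res_sub_le z f y : K z -> B (f, y) -> nm (J z f - f) <= normc z * nm y.
Proof.
move=> Kz fy; rewrite (res_sub Kz fy) nmN nmZ.
by rewrite ler_wpM2l ?normc_ge0 ?(res_contr BJ).
Qed.

(** (1 + a B) (1 + b B) and 1 + (a + b) B differ by a b B^2, so their inverses
    differ by a b B^2 composed with contractions. *)
Lemma res_mul_le a b f y w : K a -> K b -> K (a + b) ->
  B (f, y) -> B (y, w) ->
  nm (J a (J b f) - J (a + b) f) <= normc a * normc b * nm w.
Proof.
move=> Ka Kb Kab fy yw.
set F := J (a + b) f; set Y := J (a + b) y; set W := J (a + b) w.
have FY : B (F, Y) by exact: res_graph.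
have YW : B (Y, W) by exact: res_graph.
have Ff : F + (a + b) *: Y = f.
  by rewrite -[RHS](res_inv BJ Kab fy) linearD linearZ.
have JJ : J a (J b (f + (a * b) *: W)) = F.
  rewrite (_ : f + _ = (F + a *: Y) + b *: (Y + a *: W)).
    by rewrite !(res_inv BJ)//; apply: graphD => //; exact: graphZ.
  by rewrite -Ff scalerDl scalerDr !scalerA (mulrC b) !addrA.
have -> : J a (J b f) - F = - ((a * b) *: J a (J b W)).
  move: JJ; rewrite 2!linearD 2!linearZ => /(canRL (addrK _)) ->.
  by rewrite -addrAC subrr sub0r.
rewrite nmN nmZ ComplexField.Normc.normcM.
rewrite ler_wpM2l ?mulr_ge0 ?normc_ge0//.
by do !(rewrite (le_trans (res_contr BJ _ _))//).
Qed.

(** Second-order Taylor expansion of b |-> (J b)^n at b = a.  Its induction step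
    relies on J b - J a = - (b - a) J b (J a) B, where b - a need not lie in K:
    increments in all complex directions are allowed, as holomorphy demands. *)
Lemma res_iter_taylor a b n f y w : K a -> K b -> B (f, y) -> B (y, w) ->
  nm (iter n (J b) f - iter n (J a) f
      + (n%:R * (b - a)) *: iter n.+1 (J a) y)
  <= n%:R ^+ 2 * normc (b - a) ^+ 2 * nm w.
Proof.
move=> Ka Kb fy yw; set d := b - a.
have sub g v : B (g, v) -> J b g - J a g = - (d *: J b (J a v)).
  move=> gv; have := res_inv BJ Ka gv; rewrite linearD linearZ => e.
  have := res_inv BJ Kb (res_graph Ka gv).
  have -> : J a g + b *: J a v = g + d *: J a v.
    by rewrite -[in RHS]e -addrA -scalerDl /d (addrC a) subrK.
  by rewrite linearD linearZ => <-; rewrite opprD addrA subrr sub0r.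
clearbody d; elim: n => [|n IHn].
  by rewrite /= subrr mul0r scale0r addr0 nm0 expr0n/= !mul0r.
pose P := J b; pose Q := J a.
have Gy m : B (iter m Q y, iter m Q w) by exact: res_iter_graph.
have Gf m : B (iter m Q f, iter m Q y) by exact: res_iter_graph.
pose X := iter n (J b) f - iter n (J a) f + (n%:R * d) *: iter n.+1 Q y.
have -> : iter n.+1 (J b) f - iter n.+1 (J a) f
      + (n.+1%:R * d) *: iter n.+2 (J a) y =
    J b X - (n.+1%:R * d) *: (J b (iter n.+1 Q y) - J a (iter n.+1 Q y)).
  rewrite /X linearD linearB linearZ /=.
  have := sub _ _ (Gf n); rewrite -/Q => /(canRL (subrK _)) ->.
  rewrite -natr1 mulrDl mul1r scalerBr -/Q /=.
  set M := (_ + d) *: Q _; rewrite scalerDl.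
  set p := J b (iter _ _ _); set q := Q (iter _ _ f); set v := J b _.
  rewrite !opprD !opprK !addrA.
  by rewrite [RHS](ACl ((1*3*7)*(4*5)*(2*6)))/= !subrr !addr0.
rewrite (le_trans (nmB _ _))// nmZ ComplexField.Normc.normcM.
have -> : normc (n.+1%:R : R[i]) = n.+1%:R.
  by rewrite -(rmorph_nat (real_complex R)) /= expr0n addr0 sqrtr_sqr normr_nat.
have h1 := le_trans (res_contr BJ X Kb) IHn.
have h2 : nm (J b (iter n.+1 Q y) - J a (iter n.+1 Q y)) <= normc d * nm w.
  rewrite (sub _ _ (Gy n.+1)) nmN nmZ ler_wpM2l ?normc_ge0//.
  by do 2!(rewrite (le_trans (res_contr BJ _ _))//); exact: res_iter_contr.
apply: le_trans (lerD h1 (ler_wpM2l _ h2)) _.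
  by rewrite mulr_ge0 ?normc_ge0.
rewrite -natr1; have n0 : 0 <= n%:R :> R by [].
have : 0 <= normc d ^+ 2 * nm w * n%:R 
  by do 2!apply: mulr_ge0 => //; [exact: sqr_ge0|exact: nm_ge0].
nra.
Qed.

End resolvents.

(** * The semigroup as a limit of backward Euler schemes *)

Lemma cvg_half (R : realType) (c : R) : c * 2^-1 ^+ k @[k --> \oo] --> (0 : R).
Proof.
rewrite -(mulr0 c); apply: cvgMr; apply: cvg_expr.
by rewrite ger0_norm ?invr_ge0// invf_lt1 ?ltr1n.
Qed.

Section geometric.
Variables (R : realType) (H : normedModType R[i]).

Lemma geometric_cvg (u : nat -> H) (c : R) : cauchy_complete H ->
  (forall k, nm (u k.+1 - u k) <= c * 2^-1 ^+ k) -> cvg (u @ \oo).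
Proof.
move=> Hc uc; apply: Hc => e e0.
have c0 : 0 <= c.
  by have := le_trans (nm_ge0 _) (uc 0); rewrite expr0 mulr1.
have p0 k : 0 <= 2^-1 ^+ k :> R by rewrite exprn_ge0// invr_ge0.
have step k j : nm (u (k + j)%N - u k) <= 2 * c * (2^-1 ^+ k - 2^-1 ^+ (k + j)).
  elim: j => [|j IHj]; first by rewrite addn0 !subrr nm0 mulr0.
  rewrite addnS (le_trans (nm_triangle _ (u (k + j)%N) _))//.
  have := uc (k + j)%N; rewrite exprS.
  have := p0 (k + j)%N; move: IHj; lra.
have /cvgrPdist_le/(_ _ e0)[N _ hN] := cvg_half (4 * c).
have half k j : (N <= k)%N -> nm (u (k + j)%N - u k) <= e / 2.
  move=> /hN /=; rewrite sub0r normrN ger0_norm ?mulr_ge0// => h.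
  apply: le_trans (step k j) _.
  have := mulr_ge0 c0 (p0 (k + j)%N); lra.
exists N => i j Ni Nj.
have := half N (i - N)%N (leqnn _); have := half N (j - N)%N (leqnn _).
rewrite !subnKC// => h1 h2.
by have := nm_triangle (u i) (u N) (u j); rewrite (nm_distC (u N)); lra.
Qed.

Lemma dense_eq (P Q : {linear H -> H}) (D : set H) : dense_set D ->
  (forall f, nm (P f) <= nm f) -> (forall f, nm (Q f) <= nm f) ->
  (forall f, D f -> P f = Q f) -> P =1 Q.
Proof.
move=> Dd Pc Qc PQ f; apply/eqP; rewrite -subr_eq0; apply/eqP/nm_eq0.
apply/eqP; rewrite eq_le nm_ge0 andbT; apply/ler_addgt0Pr => e e0.
have e20 : 0 < e / 2 by rewrite divr_gt0.
have [g Dg fg] := Dd f _ e20.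
have -> : P f - Q f = P (f - g) - Q (f - g).
  by rewrite (linearB P) (linearB Q) (PQ g)// opprB addrA subrK.
apply: le_trans (nmB _ _) _.
by have := Pc (f - g); have := Qc (f - g); lra.
Qed.

Lemma dense_approx (P : {linear H -> H}) f g :
  (forall f, nm (P f) <= nm f) ->
  nm (P f - f) <= 2 * nm (f - g) + nm (P g - g).
Proof.
move=> Pc; have -> : P f - f = P (f - g) + (P g - g) - (f - g).
  by rewrite linearB opprB !addrA !subrK.
by have := nmB (P (f - g) + (P g - g)) (f - g);
  have := nmD (P (f - g)) (P g - g); have := Pc (f - g); lra.
Qed.

End geometric.

Section semigroup.
Variables (R : realType) (H : normedModType R[i]).
Variables (B : set (H * H)) (K : set R[i]) (J : R[i] -> {linear H -> H}).
Implicit Types (f g y w : H) (a b z : R[i]).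

Record convex_cone : Prop := {
  cone1 : K 1 ;
  coneD : forall a b, K a -> K b -> K (a + b) ;
  coneZ : forall (t : R) z, 0 <= t -> K z -> K (t%:C * z) }.

Hypotheses (BJ : contractive_resolvents B K J) (KC : convex_cone).
Hypothesis Hc : cauchy_complete H.
Hypothesis Bd : dense_set [set f | exists y, B (f, y)].

Lemma cone0 : K 0.
Proof. by have := coneZ KC (lexx 0) (cone1 KC); rewrite mul0r. Qed.

Lemma coneR (t : R) : 0 <= t -> K t%:C.
Proof. by move=> t0; have := coneZ KC t0 (cone1 KC); rewrite mulr1. Qed.

Lemma normcR (t : R) : normc t%:C = `|t|.
Proof. by rewrite /= expr0n/= addr0 sqrtr_sqr. Qed.

(** J s maps the domain of B into that of B^2 and tends to the identity as s
    tends to 0. *)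
Lemma dense_square : dense_set [set f | exists y w, B (f, y) /\ B (y, w)].
Proof.
move=> f e e0; have e20 : 0 < e / 2 by rewrite divr_gt0.
have [g [y gy] fg] := Bd f e20.
have y0 : 0 < 1 + nm y by rewrite ltr_pwDl ?nm_ge0.
pose s := e / 2 / (1 + nm y); have s0 : 0 < s by rewrite !divr_gt0.
have Ks := coneR (ltW s0); have sN0 : s%:C != 0 by rewrite gt_eqF// ltcR.
exists (J s%:C g).
  exists (J s%:C y); have [w [yw _]] := res_dom BJ y Ks sN0.
  by exists w; split=> //; exact: (res_graph BJ).
have := res_sub_le BJ Ks gy; rewrite normcR gtr0_norm// => h.
have := nm_triangle f g (J s%:C g); rewrite (nm_distC g).
have : s * nm y <= e / 2 by rewrite /s mulrAC ler_pdivrMr// ler_pM2l//; lra.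
by lra.
Qed.

(** B consists of the pairs (f, y) with J 1 (f + y) = f, and J 1 is
    continuous. *)
Lemma graph_closed (u v : nat -> H) f y : (forall k, B (u k, v k)) ->
  u @ \oo --> f -> v @ \oo --> y -> B (f, y).
Proof.
move=> Buv uf vy; have K1 := cone1 KC.
have Jc : continuous (J 1).
  by apply: (@bounded_continuous _ _ _ 1) => g; rewrite mul1r (res_contr BJ).
have fE : J 1 (f + y) = f.
  apply: (cvg_unique (@norm_hausdorff _ H) _ uf).
  rewrite (_ : u = (fun k => J 1 (u k + v k))); last first.
    by apply/funext => k; rewrite -[v k]scale1r (res_inv BJ).
  by apply: (cvg_comp _ _ (cvgD uf vy)); exact: Jc.
have [y' []] := res_dom BJ (f + y) K1 (oner_neq0 _).
by rewrite fE scale1r => By' /addrI <-.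
Qed.

(** Halving the step turns the k-th scheme into the next one, so that dyadic
    numbers of steps make the convergence a geometric series. *)
Definition euler k z := iter (2 ^ k) (J ((2^-1 ^+ k)%:C * z)).

Lemma cone_step k z : K z -> K ((2^-1 ^+ k)%:C * z).
Proof. by apply: (coneZ KC); rewrite exprn_ge0. Qed.

Lemma step_normc k z : normc ((2^-1 ^+ k)%:C * z) = 2^-1 ^+ k * normc z.
Proof.
by rewrite ComplexField.Normc.normcM normcR ger0_norm// exprn_ge0.
Qed.

Lemma steps_mul k : (2 ^ k)%:R * 2^-1 ^+ k = 1 :> R.
Proof. by rewrite natrX -exprMn divff ?expr1n ?pnatr_eq0. Qed.

Lemma euler_linear k z : linear (euler k z).
Proof. exact: iter_linear. Qed.

Lemma euler_contr k z f : K z -> nm (euler k z f) <= nm f.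
Proof. by move=> /(cone_step k); exact: (res_iter_contr BJ). Qed.

Lemma euler_graph k z f y : K z -> B (f, y) -> B (euler k z f, euler k z y).
Proof. by move=> /(cone_step k); exact: (res_iter_graph BJ). Qed.

Lemma euler_mul_le k a b f y w : K a -> K b -> B (f, y) -> B (y, w) ->
  nm (euler k a (euler k b f) - euler k (a + b) f)
  <= normc a * normc b * nm w * 2^-1 ^+ k.
Proof.
move=> Ka Kb fy yw; have Kab := coneD KC Ka Kb.
have Kak := cone_step k Ka; have Kbk := cone_step k Kb.
have Kabk := cone_step k Kab.
rewrite /euler mulrDr -mulrDr; set n := (2 ^ k)%N.
set ha := _ * a; set hb := _ * b; set hab := _ * (a + b).
rewrite iter_mul; last by move=> g; exact: (res_comm BJ).
have := @iter_sub_le _ _ (J ha \o J hb) (J hab) n f.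
have JJc g : nm ((J ha \o J hb) g) <= nm g.
  by do 2!rewrite (le_trans (res_contr BJ _ _))//.
have Jc g : nm (J hab g) <= nm g by exact: (res_contr BJ).
have JJ g : (J ha \o J hb) (J hab g) = J hab ((J ha \o J hb) g).
  by rewrite /= (res_comm BJ _ Kbk)// (res_comm BJ _ Kak).
move=> /(_ JJ JJc Jc)/le_trans; apply.
have habE : hab = ha + hb by rewrite /hab mulrDr.
have := @res_mul_le _ _ _ _ _ BJ ha hb f y w Kak Kbk.
rewrite -habE => /(_ Kabk fy yw); rewrite !step_normc => h.
rewrite (le_trans (ler_wpM2l _ h))// le_eqVlt; apply/orP; left; apply/eqP.
transitivity ((n%:R * 2^-1 ^+ k) * (normc a * normc b * nm w * 2^-1 ^+ k)).
  by ring.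
by rewrite steps_mul mul1r.
Qed.

Lemma euler_cvg z f y w : K z -> B (f, y) -> B (y, w) ->
  cvg (euler k z f @[k --> \oo]).
Proof.
move=> Kz fy yw.
apply: (@geometric_cvg _ _ _ (normc z ^+ 2 * nm w)) => // k.
have z2 : 2^-1%:C * z + 2^-1%:C * z = z.
  rewrite -mulrDl -rmorphD (_ : 2^-1 + 2^-1 = 1) ?mul1r//.
  by rewrite [RHS](splitr 1) div1r.
have K2 : K (2^-1%:C * z) by apply: (coneZ KC) => //; rewrite invr_ge0.
have := euler_mul_le k K2 K2 fy yw; rewrite z2.
have -> : euler k (2^-1%:C * z) (euler k (2^-1%:C * z) f) = euler k.+1 z f.
  by rewrite /euler mulrA -rmorphM -exprSr expnS mul2n -addnn iterD.
move/le_trans; apply; rewrite ler_wpM2r ?exprn_ge0 ?invr_ge0//.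
rewrite ler_wpM2r ?nm_ge0// -expr2 ler_pXn2r ?nnegrE ?normc_ge0//.
rewrite ComplexField.Normc.normcM normcR ger0_norm ?invr_ge0//.
by rewrite ler_piMl ?normc_ge0// invf_le1// ler1n.
Qed.

(** The schemes are contractions and converge geometrically on the domain of
    B^2, which is dense. *)
Lemma euler_limit : exists T : R[i] -> {linear H -> H},
  forall z f, K z -> euler k z f @[k --> \oo] --> T z f.
Proof.
suff /choice[T TP] : forall z, exists L : {linear H -> H},
    forall f, K z -> euler k z f @[k --> \oo] --> L f by exists T.
move=> z; have [Kz|nKz] := pselect (K z); last by exists (J z).
have [] := @strong_limit _ _ (fun k => euler k z) 1 _ Hc _ _ dense_square.
- by move=> k; exact: euler_linear.
- by move=> k f; rewrite mul1r; exact: euler_contr.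
- by move=> g [y [w [gy yw]]]; exact: euler_cvg gy yw.
by move=> L [_ LE]; exists L => f _; exact: LE.
Qed.

Variable T : R[i] -> {linear H -> H}.
Hypothesis TE : forall z f, K z -> euler k z f @[k --> \oo] --> T z f.

Lemma sg_contr z f : K z -> nm (T z f) <= nm f.
Proof.
move=> Kz.
apply: (@cvg_nm_le _ _ (fun k => euler k z f) (fun=> nm f)) => [||k].
- exact: TE.
- exact: cvg_cst.
exact: euler_contr.
Qed.

Lemma sg_continuous z : K z -> continuous (T z).
Proof.
move=> Kz; apply: (@bounded_continuous _ _ _ 1) => f.
by rewrite mul1r sg_contr.
Qed.

Lemma sg_cvg z (u : nat -> H) f : K z -> u @ \oo --> f ->
  T z (u k) @[k --> \oo] --> T z f.
Proof.
move=> Kz uf; apply: (@cvg_comp _ _ _ u (T z) \oo (nbhs f)) => //.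
exact: sg_continuous.
Qed.

Lemma sg_graph z f y : K z -> B (f, y) -> B (T z f, T z y).
Proof.
move=> Kz fy.
apply: (@graph_closed (fun k => euler k z f) (fun k => euler k z y)) => [k||].
- exact: euler_graph.
- exact: TE.
- exact: TE.
Qed.

Lemma euler_cvg_comp z (u : nat -> H) f : K z -> u @ \oo --> f ->
  euler k z (u k) @[k --> \oo] --> T z f.
Proof.
move=> Kz uf; rewrite (_ : (fun k => _) =
    (fun k => euler k z (u k - f) + euler k z f)); last first.
  by apply/funext => k; rewrite -iter_addv subrK.
rewrite -[T z f]add0r; apply: cvgD; last exact: TE.
apply/cvg_nmP => e e0; move/cvg_nmP/(_ _ e0): uf; apply: filterS => k.
by rewrite sub0r nmN nm_distC; apply: le_trans; exact: euler_contr.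
Qed.

(** Both sides are contractions, and on the domain of B^2 the schemes differ by
    O(2^-k). *)
Lemma sg_mul a b f : K a -> K b -> T (a + b) f = T a (T b f).
Proof.
move=> Ka Kb; have Kab := coneD KC Ka Kb; pose Tab := T a \o T b.
rewrite -[RHS]/((T a \o T b) f); apply: (dense_eq dense_square).
- by move=> g; exact: sg_contr.
- by move=> g /=; do 2!rewrite (le_trans (sg_contr _ _))//.
move=> g [y [w [gy yw]]] /=.
apply/esym/eqP; rewrite -subr_eq0; apply/eqP/nm_eq0.
apply/eqP; rewrite eq_le nm_ge0 andbT.
apply: (@cvg_nm_le _ _
  (fun k => euler k a (euler k b g) - euler k (a + b) g)
  (fun k => normc a * normc b * nm w * 2^-1 ^+ k)) => [||k].
- by apply: cvgB; [apply: euler_cvg_comp => //|]; exact: TE.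
- exact: cvg_half.
- exact: euler_mul_le gy yw.
Qed.

Lemma sg0 f : T 0 f = f.
Proof.
have := @TE 0 f cone0; rewrite (_ : (fun k => _) = cst f) => [h|].
  exact: (cvg_unique (@norm_hausdorff _ H) h (cvg_cst f)).
apply/funext => k /=; rewrite /euler mulr0.
by elim: (2 ^ k)%N => //= n ->; rewrite (res_zero BJ).
Qed.

Lemma sg_taylor z v f y w : K z -> K (z + v) -> B (f, y) -> B (y, w) ->
  nm (T (z + v) f - T z f + v *: T z y) <= normc v ^+ 2 * nm w.
Proof.
move=> Kz Kzv fy yw.
have lim1 : J ((2^-1 ^+ k)%:C * z) (euler k z y) @[k --> \oo] --> T z y.
  rewrite (_ : (fun k => _) =
    (fun k => euler k z (J ((2^-1 ^+ k)%:C * z) y))); last first.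
    by apply/funext => k; rewrite /euler -iterS -iterSr.
  apply: euler_cvg_comp => //.
  apply: (cvg_nm_squeeze (cvg_half (normc z * nm w))).
  near=> k; have := res_sub_le BJ (cone_step k Kz) yw.
  by rewrite step_normc; lra.
apply: (@cvg_nm_le _ _ (fun k => euler k (z + v) f - euler k z f +
    v *: J ((2^-1 ^+ k)%:C * z) (euler k z y))
  (fun=> normc v ^+ 2 * nm w)) => [||k].
- apply: cvgD; first by apply: cvgB; exact: TE.
  exact: cvgZl_tmp.
- exact: cvg_cst.
have := @res_iter_taylor _ _ _ _ _ BJ _ _ (2 ^ k) _ _ _
  (cone_step k Kz) (cone_step k Kzv) fy yw.
have -> : (2^-1 ^+ k)%:C * (z + v) - (2^-1 ^+ k)%:C * z = (2^-1 ^+ k)%:C * v.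
  by rewrite mulrDr addrC addKr.
have -> : (2 ^ k)%:R * ((2^-1 ^+ k)%:C * v) = v.
  by rewrite mulrA -(rmorph_nat (real_complex R)) -rmorphM steps_mul mul1r.
by rewrite step_normc -exprMn mulrA steps_mul mul1r.
Unshelve. all: by end_near. Qed.

Lemma sg_sub_le z f y : K z -> B (f, y) -> nm (T z f - f) <= normc z * nm y.
Proof.
move=> Kz fy.
apply: (@cvg_nm_le _ _ (fun k => euler k z f - f)
  (fun=> normc z * nm y)) => [||k].
- by apply: cvgB; [exact: TE|exact: cvg_cst].
- exact: cvg_cst.
have h : K ((2^-1 ^+ k)%:C * z) by exact: cone_step.
have := @iter_sub_le _ _ (J ((2^-1 ^+ k)%:C * z)) (J 0) (2 ^ k) f.
have -> : iter (2 ^ k) (J 0) f = f.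
  by elim: (2 ^ k)%N => //= n ->; rewrite (res_zero BJ).
have J0 g : J 0 g = g by exact: (res_zero BJ).
have JJ g : J ((2^-1 ^+ k)%:C * z) (J 0 g) = J 0 (J ((2^-1 ^+ k)%:C * z) g).
  by rewrite !J0.
have Jc g : nm (J ((2^-1 ^+ k)%:C * z) g) <= nm g by exact: (res_contr BJ).
have Jc0 g : nm (J 0 g) <= nm g by rewrite J0.
move=> /(_ JJ Jc Jc0)/le_trans; apply; rewrite J0.
rewrite (le_trans (ler_wpM2l _ (res_sub_le BJ h fy)))//.
by rewrite step_normc !mulrA steps_mul mul1r.
Qed.

Lemma ball_pos (e c : R) : 0 < e -> 0 <= c ->
  exists2 d : R, 0 < d & forall r, 0 <= r <= d -> r * c <= e.
Proof.
move=> e0 c0; have c1 : 0 < 1 + c by rewrite ltr_pwDl.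
exists (e / (1 + c)); first by rewrite divr_gt0.
by move=> r /andP[r0]; rewrite ler_pdivlMr//; nra.
Qed.

Lemma sg_cvg0 f (e : R) : 0 < e -> exists2 d : R, 0 < d &
  forall z, K z -> normc z <= d -> nm (T z f - f) <= e.
Proof.
move=> e0; have e40 : 0 < e / 4 by rewrite divr_gt0.
have e20 : 0 < e / 2 by rewrite divr_gt0.
have [g [y gy] fg] := Bd f e40.
have [d d0 dP] := ball_pos e20 (nm_ge0 y); exists d => // z Kz zd.
have := dense_approx f g (fun g => sg_contr g Kz).
have := sg_sub_le Kz gy; have := dP (normc z); rewrite normc_ge0 zd => /(_ isT).
by lra.
Qed.

(** On the domain of B^2 this is the case z = 0 of [sg_taylor].  An f in the
    domain of B is replaced by f' = J 1 g, with g in the domain of B close to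
    f + B f: then f' and B f' are close to f and B f, and [sg_sub_le] bounds
    the effect of the replacement by a small multiple of |z|. *)
Lemma sg_derive0 f y (e : R) : B (f, y) -> 0 < e -> exists2 d : R, 0 < d &
  forall z, K z -> normc z <= d -> nm (T z f - f + z *: y) <= e * normc z.
Proof.
move=> fy e0; have e80 : 0 < e / 8 by rewrite divr_gt0.
have e20 : 0 < e / 2 by rewrite divr_gt0.
have K1 := cone1 KC.
have fE : f = J 1 (f + y) by rewrite -[y]scale1r (res_inv BJ).
have [g [w gw] hg] := Bd (f + y) e80.
have [y' [fy' ge]] := res_dom BJ g K1 (oner_neq0 _); set f' := J 1 g in fy' ge.
have yw' : B (y', w - y').
  have {1}-> : y' = g - f' by rewrite -ge scale1r addrC addKr.
  exact: (graphB BJ).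
have ff' : nm (f - f') <= e / 8.
  by rewrite fE /f' -linearB (le_trans (res_contr BJ _ K1)).
have yy' : nm (y - y') <= e / 4.
  have -> : y - y' = (f + y - g) - (f - f').
    have gE : g = f' + y' by rewrite -ge scale1r.
    rewrite gE opprB opprD !addrA.
    by rewrite [RHS](ACl ((2*4)*(1*6)*(3*5)))/= addrN addNr !addr0.
  have := nmB (f + y - g) (f - f'); lra.
have [d d0 dP] := ball_pos e20 (nm_ge0 (w - y')); exists d => // z Kz zd.
have -> : T z f - f + z *: y = (T (0 + z) f' - T 0 f' + z *: T 0 y')
    + (T z (f - f') - (f - f')) + z *: (y - y').
  rewrite !sg0 add0r linearB scalerBr.
  set a := T z f; set b := T z f'; set c := z *: y; set c' := z *: y'.
  rewrite !opprB !addrA.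
  rewrite [RHS](ACl ((4*7*8)*((1*5)*(2*6)*(3*9))))/=.
  by rewrite addrN addNr addrN !addr0.
have K0z : K (0 + z) by rewrite add0r.
have h1 := sg_taylor cone0 K0z fy' yw'.
have h2 := sg_sub_le Kz (graphB BJ fy fy').
apply: le_trans (nmD _ _) _; rewrite nmZ.
have h3 := nmD (T (0 + z) f' - T 0 f' + z *: T 0 y') (T z (f - f') - (f - f')).
have := dP (normc z); rewrite normc_ge0 zd => /(_ isT) h4.
have := normc_ge0 z; nra.
Qed.

Lemma res_cvg f : J (2^-1 ^+ k)%:C f @[k --> \oo] --> f.
Proof.
apply/cvg_nmP => e e0; have e40 : 0 < e / 4 by rewrite divr_gt0.
have e20 : 0 < e / 2 by rewrite divr_gt0.
have [g [y gy] fg] := Bd f e40.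
have /cvgrPdist_le/(_ _ e20) := cvg_half (nm y); apply: filterS => k.
have p0 : 0 <= 2^-1 ^+ k :> R by rewrite exprn_ge0.
rewrite sub0r normrN ger0_norm ?mulr_ge0 ?nm_ge0// => h.
have Kk := coneR p0; rewrite nm_distC.
have := dense_approx f g (fun g => res_contr BJ g Kk).
have := res_sub_le BJ Kk gy; rewrite normcR ger0_norm//; lra.
Qed.

(** L extends f |-> T z (B f) from the domain of B: it is the strong limit of
    T z composed with the bounded approximations Q of B, and B is closed. *)
Lemma sg_into_domain z c : K z -> 0 <= c ->
  (forall f y, B (f, y) -> nm (T z y) <= c * nm f) ->
  exists L : {linear H -> H},
    (forall f, nm (L f) <= c * nm f) /\ forall f, B (T z f, L f).
Proof.
move=> Kz c0 smooth; pose s k : R := 2^-1 ^+ k.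
have s0 k : 0 < s k by rewrite exprn_gt0// invr_gt0.
have Ks k : K (s k)%:C by apply: coneR; exact: ltW.
pose Q k f := (s k)%:C^-1 *: (f - J (s k)%:C f).
have sN0 k : (s k)%:C != 0 by rewrite gt_eqF// ltcR.
have QB k f : B (J (s k)%:C f, Q k f).
  have [y [fy e]] := res_dom BJ f (Ks k) (sN0 k).
  rewrite /Q (_ : f - _ = (s k)%:C *: y) ?scalerA ?mulVf ?scale1r//.
  by rewrite -{1}e addrC addKr.
have QJ k f y : B (f, y) -> Q k f = J (s k)%:C y.
  move=> fy; rewrite /Q -opprB (res_sub BJ (Ks k) fy) opprK.
  by rewrite scalerA mulVf// scale1r.
have [] := @strong_limit _ _ (fun k f => T z (Q k f)) c
    [set f | exists y, B (f, y)] Hc _ _ Bd.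
- move=> k a f g; rewrite -linearP; congr (T z _).
  rewrite /Q !linearP scalerA mulrC -scalerA -scalerDr; congr (_ *: _).
  by rewrite [in RHS]scalerDr addrACA.
- move=> k f; apply: le_trans (smooth _ _ (QB k f)) _.
  by rewrite ler_wpM2l// (res_contr BJ).
- move=> f [y fy]; apply/cvg_ex; exists (T z y).
  rewrite (_ : (fun k => _) = (fun k => T z (J (s k)%:C y))); last first.
    by apply/funext => k; rewrite (QJ _ _ _ fy).
  by apply: sg_cvg => //; exact: res_cvg.
move=> L [Lc LE]; exists L; split=> // f.
apply: (@graph_closed (fun k => T z (J (s k)%:C f)) (fun k => T z (Q k f))).
- by move=> k; exact: sg_graph.
- by apply: sg_cvg => //; exact: res_cvg.
- exact: LE.
Qed.

(** The point at which the derivative is taken is 4 a.  One factor T (a + a)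
    regularises f into the domain of B^2, the other absorbs the increment v, so
    that only a + a + v has to stay in K. *)
Lemma sg_differentiable a c : K a -> 0 <= c ->
  (forall f y, B (f, y) -> nm (T a y) <= c * nm f) ->
  exists D : {linear H -> H}, (forall f, nm (D f) <= c * nm f) /\
    forall v f, K (a + a + v) ->
      nm (T (a + a + v + (a + a)) f - T (a + a + (a + a)) f - v *: D f)
      <= c ^+ 2 * normc v ^+ 2 * nm f.
Proof.
move=> Ka c0 smooth; have [L [Lc LB]] := sg_into_domain Ka c0 smooth.
have Kaa : K (a + a) by exact: (coneD KC).
have [D DE] : exists D : {linear H -> H},
    forall f, D f = - T (a + a) (T a (L f)).
  apply: (@linear_pack _ _ (fun f => - T (a + a) (T a (L f)))) => s f g.
  by rewrite (linearP L) (linearP (T a)) (linearP (T _)) opprD scalerN.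
exists D; split=> [f|v f Kv].
  rewrite DE nmN (le_trans _ (Lc f))// (le_trans (sg_contr _ Kaa))//.
  exact: sg_contr.
rewrite (sg_mul _ Kv Kaa) (sg_mul _ Kaa Kaa) DE scalerN opprK.
have h1 : B (T (a + a) f, T a (L f)) by rewrite sg_mul//; exact: sg_graph.
have := sg_taylor Kaa Kv h1 (LB (L f)); move/le_trans; apply.
have h2 := Lc f; have h3 : nm (L (L f)) <= c * (c * nm f).
  by rewrite (le_trans (Lc _))// ler_wpM2l.
have := ler_wpM2l (sqr_ge0 (normc v)) h3; lra.
Qed.

End semigroup.

(** * Sectors and sectorial forms *)

Section complex_parts.
Variable R : realType.
Implicit Types z w : R[i].

Lemma cReD z w : complex.Re (z + w) = complex.Re z + complex.Re w.
Proof. by case: z; case: w. Qed.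
Lemma cImD z w : complex.Im (z + w) = complex.Im z + complex.Im w.
Proof. by case: z; case: w. Qed.
Lemma cReM z w : complex.Re (z * w) =
  complex.Re z * complex.Re w - complex.Im z * complex.Im w.
Proof. by case: z; case: w. Qed.
Lemma cImM z w : complex.Im (z * w) =
  complex.Re z * complex.Im w + complex.Im z * complex.Re w.
Proof. by case: z; case: w. Qed.
Lemma cReC z : complex.Re z^* = complex.Re z. Proof. by case: z. Qed.
Lemma cImC z : complex.Im z^* = - complex.Im z. Proof. by case: z. Qed.

Lemma parts_le_normc z :
  `|complex.Re z| <= normc z /\ `|complex.Im z| <= normc z.
Proof.
by case: z => x y /=; split; rewrite -sqrtr_sqr ler_sqrt ?addr_ge0 ?sqr_ge0//
  ?lerDl ?lerDr sqr_ge0.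
Qed.

End complex_parts.

Section sector_cone.
Variables (R : realType) (tau : R).
Hypothesis tau0 : 0 <= tau.

(** The open sector of half-angle pi/2 - arctan tau, in a form that makes its
    convexity and openness elementary. *)
Definition ocone : set R[i] := [set z | tau * `|complex.Im z| < complex.Re z].
Definition cone : set R[i] := [set z | z = 0 \/ ocone z].

Lemma ocone_Re z : ocone z -> 0 < complex.Re z.
Proof. by apply: le_lt_trans; rewrite mulr_ge0. Qed.

Lemma oconeD z w : ocone z -> ocone w -> ocone (z + w).
Proof.
rewrite /ocone /= cReD cImD => hz hw; apply: le_lt_trans (ltrD hz hw).
by rewrite -mulrDr ler_wpM2l// ler_normD.
Qed.

Lemma oconeZ (t : R) z : 0 < t -> ocone z -> ocone (t%:C * z).
Proof.
move=> t0; rewrite /ocone /= cReM cImM /= !mul0r subr0 addr0 normrM gtr0_norm//.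
by rewrite mulrCA ltr_pM2l.
Qed.

Lemma cone_convex : convex_cone cone.
Proof.
split.
- by right; rewrite /ocone /= normr0 mulr0.
- move=> z w [->|hz] [->|hw]; rewrite ?add0r ?addr0; [by left|by right..|].
  by right; exact: oconeD.
- move=> t z; rewrite le_eqVlt => /predU1P[<-|t0]; first by rewrite mul0r; left.
  move=> [->|hz]; first by rewrite mulr0; left.
  by right; exact: oconeZ.
Qed.

Lemma ocone_open z : ocone z -> exists2 r : R, 0 < r &
  forall v, normc v <= r -> ocone (z + v).
Proof.
move=> hz; pose r := (complex.Re z - tau * `|complex.Im z|) / (2 * (1 + tau)).
have t1 : 0 < 1 + tau by rewrite ltr_pwDl.
have r0 : 0 < r by rewrite divr_gt0 ?mulr_gt0// subr_gt0.
exists r => // v vr.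
have rE : 2 * ((1 + tau) * r) = complex.Re z - tau * `|complex.Im z|.
  by rewrite mulrA mulrC /r divfK// gt_eqF// mulr_gt0.
have [v1 v2] := parts_le_normc v.
have /ler_normlP[h1 _] := le_trans v1 vr; have h2 := le_trans v2 vr.
rewrite /ocone /= cReD cImD.
have := ler_wpM2l tau0 (ler_normD (complex.Im z) (complex.Im v)).
have := ler_wpM2l tau0 h2.
have := mulr_gt0 t1 r0; lra.
Qed.

End sector_cone.

Section inner_products.
Variables (R : realType) (H : normedModType R[i]).
Implicit Types (f g h : H).

Record inner_product (dot : H -> H -> R[i]) : Prop := {
  dot_linear : forall c f g h, dot (c *: f + g) h = c * dot f h + dot g h ;
  dot_conj : forall f g, dot g f = (dot f g)^* ;
  dot_nm : forall f, dot f f = (nm f ^+ 2)%:C }.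

Variable dot : H -> H -> R[i].
Hypothesis dotP : inner_product dot.

Lemma dotDl f g h : dot (f + g) h = dot f h + dot g h.
Proof. by have := dot_linear dotP 1 f g h; rewrite scale1r mul1r. Qed.

Lemma dot0l h : dot 0 h = 0.
Proof. by apply: (addrI (dot 0 h)); rewrite -dotDl !addr0. Qed.

Lemma dotZl c f h : dot (c *: f) h = c * dot f h.
Proof. by rewrite -[c *: f]addr0 (dot_linear dotP) dot0l addr0. Qed.

Lemma dotDr f g h : dot h (f + g) = dot h f + dot h g.
Proof. by rewrite !(dot_conj dotP _ h) dotDl rmorphD. Qed.

Lemma dotZr c f h : dot h (c *: f) = c^* * dot h f.
Proof. by rewrite !(dot_conj dotP _ h) dotZl rmorphM. Qed.

Lemma nm_sqrD f g :
  nm (f + g) ^+ 2 = nm f ^+ 2 + nm g ^+ 2 + 2 * complex.Re (dot g f).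
Proof.
have nmRe h : nm h ^+ 2 = complex.Re (dot h h) by rewrite (dot_nm dotP).
rewrite !nmRe dotDl !dotDr !cReD (dot_conj dotP g f) cReC; ring.
Qed.

Variables (P : set (H * H)) (kappa : R).
Hypothesis Plin : forall c f y g w, P (f, y) -> P (g, w) ->
  P (c *: f + g, c *: y + w).
Hypothesis Psector : forall f y, P (f, y) ->
  `|complex.Im (dot y f)| <= kappa * complex.Re (dot y f).
Hypothesis Paccr : forall f y, P (f, y) -> 0 <= complex.Re (dot y f).

(** The symmetric part q of the form (f, g) |-> <P f, g> is nonnegative, so
    q (f - g) >= 0 bounds the symmetric part of Re <P f, g>.  The antisymmetric
    part of Re <P f, g> is that of Im <P h, h> at h = f - i g and h = f + i g,
    which sectoriality bounds by kappa q. *)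
Lemma sectorial_cauchy_schwarz (c d : R) f y g w : P (f, y) -> P (g, w) ->
  2 * c * d * complex.Re (dot y g) <=
  (1 + kappa) * (c ^+ 2 * complex.Re (dot y f) + d ^+ 2 * complex.Re (dot w g)).
Proof.
have PD f' y' g' w' : P (f', y') -> P (g', w') -> P (f' + g', y' + w').
  by move=> h1 h2; have := Plin 1 h1 h2; rewrite !scale1r.
have PB f' y' g' w' : P (f', y') -> P (g', w') -> P (f' - g', y' - w').
  by move=> h1 h2; have := Plin (- 1) h2 h1; rewrite !scaleN1r !(addrC (- _)).
have PZ e f' y' : P (f', y') -> P (e *: f', e *: y').
  by move=> h; have := Plin e h (PB _ _ _ _ h h); rewrite !subrr !addr0.
move=> /(PZ c%:C) + /(PZ d%:C).
have -> : 2 * c * d * complex.Re (dot y g) =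
    2 * complex.Re (dot (c%:C *: y) (d%:C *: g)).
  by rewrite dotZl dotZr !cReM !cImM /=; ring.
have -> : c ^+ 2 * complex.Re (dot y f) =
    complex.Re (dot (c%:C *: y) (c%:C *: f)).
  by rewrite dotZl dotZr !cReM !cImM /=; ring.
have -> : d ^+ 2 * complex.Re (dot w g) =
    complex.Re (dot (d%:C *: w) (d%:C *: g)).
  by rewrite dotZl dotZr !cReM !cImM /=; ring.
move: (c%:C *: _) (c%:C *: _) (d%:C *: _) (d%:C *: _).
move=> {c d f y g w} f y w g fy gw.
have := Paccr (PB _ _ _ _ fy gw).
have igw := PZ 'i%C _ _ gw.
have := Psector (PB _ _ _ _ fy igw); have := Psector (PD _ _ _ _ fy igw).
rewrite -!(scaleN1r (_ *: _)) -!(scaleN1r g) -!(scaleN1r w).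
rewrite !(dotDl, dotDr, dotZl, dotZr).
move: (dot y f) (dot y g) (dot w f) (dot w g) => a b c d.
rewrite !ler_norml !cReD !cImD.
rewrite !cReM !cImM !(cReM, cImM) /=.
move=> /andP[+ _] /andP[_ +].
lra.
Qed.

End inner_products.

(** * Energy decay and analytic smoothing *)

Section lyapunov.
Variables (R : realType) (H : normedModType R[i]) (dot : H -> H -> R[i]).
Hypothesis dotP : inner_product dot.
Variables (P : set (H * H)) (kappa : R).
Hypothesis Plin : forall c f y g w, P (f, y) -> P (g, w) ->
  P (c *: f + g, c *: y + w).
Hypothesis Psector : forall f y, P (f, y) ->
  `|complex.Im (dot y f)| <= kappa * complex.Re (dot y f).
Hypothesis Paccr : forall f y, P (f, y) -> 0 <= complex.Re (dot y f).
Hypothesis kappa0 : 0 <= kappa.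

(** Here u + h v and v + h w are the values before the step.  The step loses at
    least 2 h Re <v, u> and 2 h Re <w, v>, while the growth of the weight from
    p^2 to (p + 1)^2 costs at most 3 p h^2 |v|^2 and |v|^2 = Re <v, v> is
    controlled by [sectorial_cauchy_schwarz]. *)
Lemma euler_step_energy (h p : R) u v w : 0 <= h -> 1 <= p ->
  P (u, v) -> P (v, w) ->
  (p + 1) ^+ 2 * h ^+ 2 * nm v ^+ 2 + (1 + kappa) ^+ 2 * nm u ^+ 2 <=
  p ^+ 2 * h ^+ 2 * nm (v + h%:C *: w) ^+ 2
  + (1 + kappa) ^+ 2 * nm (u + h%:C *: v) ^+ 2.
Proof.
move=> h0 p1 uv vw; set M := 1 + kappa.
have M0 : 0 < M by rewrite ltr_pwDl.
have step f y : nm f ^+ 2 + 2 * h * complex.Re (dot y f) <=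
    nm (f + h%:C *: y) ^+ 2.
  rewrite (nm_sqrD dotP) (dotZl dotP) cReM /= mul0r subr0.
  by have := sqr_ge0 (nm (h%:C *: y)); lra.
(* With the weights 3 M and 4 h p, and after multiplication by h / 8, the
   coefficient of Re <w, v> is the dissipation available, 2 p^2 h^3. *)
have := @sectorial_cauchy_schwarz _ _ _ dotP _ _ Plin Psector Paccr
  (3 * M) (4 * h * p) _ _ _ _ uv vw.
rewrite -/M (dot_nm dotP) /=.
have qu := Paccr uv; have qv := Paccr vw.
move: (complex.Re (dot v u)) (complex.Re (dot w v)) qu qv (step u v) (step v w).
move=> qu qv qu0 qv0 su sv cs.
have {}cs : 24 * (h * p * nm v ^+ 2) <=
    9 * (M ^+ 2 * qu) + 16 * (h ^+ 2 * p ^+ 2 * qv).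
  by rewrite -(ler_pM2l M0); move: cs; lra.
have h1 := ler_wpM2l h0 cs.
have h2 := ler_wpM2l (mulr_ge0 (sqr_ge0 p) (sqr_ge0 h)) sv.
have h3 := ler_wpM2l (sqr_ge0 M) su.
have p10 : 0 <= p - 1 by rewrite subr_ge0.
have h4 := mulr_ge0 p10 (mulr_ge0 (sqr_ge0 h) (sqr_ge0 (nm v))).
have h5 := mulr_ge0 h0 (mulr_ge0 (sqr_ge0 M) qu0).
lra.
Qed.

End lyapunov.

(** B + l is the graph of the inverse of a linear map. *)
Lemma op_inverse_linear (R : realType) (H : normedModType R[i])
    (B : set (H * H)) (l : R[i]) (Q : {linear H -> H}) c f y g w :
  op_inverse (op_addC B l) Q -> B (f, y) -> B (g, w) ->
  B (c *: f + g, c *: y + w).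
Proof.
move=> [Q1 Q2] fy gw.
have f1 : Q (y + l *: f) = f by apply: Q2; exists (f, y).
have g1 : Q (w + l *: g) = g by apply: Q2; exists (g, w).
have [[p1 p2] Bp [/= e1 e2]] := Q1 (c *: (y + l *: f) + (w + l *: g)).
rewrite linearP f1 g1 in e1; rewrite e1 in Bp e2.
have -> : c *: y + w = p2; last by [].
apply: (addIr (l *: (c *: f + g))); rewrite e2.
by rewrite !scalerDr !scalerA (mulrC l) addrACA.
Qed.

Section sectorial_relation.
Variables (R : realType) (H : normedModType R[i]) (dot : H -> H -> R[i]).
Hypothesis dotP : inner_product dot.
Variables (B : set (H * H)) (tau : R).
Hypothesis tau0 : 0 <= tau.
Hypothesis Bsector : forall f y, B (f, y) ->
  `|complex.Im (dot y f)| <= tau * complex.Re (dot y f).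
Hypothesis Baccr : forall f y, B (f, y) -> 0 <= complex.Re (dot y f).

(** Rotating <B f, f> by z costs at most tau |Im z| of its real part. *)
Lemma ocone_accr z f y : ocone tau z -> B (f, y) ->
  (complex.Re z - tau * `|complex.Im z|) * complex.Re (dot y f) <=
  complex.Re (dot (z *: y) f).
Proof.
move=> zK fy; rewrite (dotZl dotP) cReM.
have h1 := Bsector fy; have h0 := Baccr fy.
have := ler_norm (complex.Im z * complex.Im (dot y f)); rewrite normrM.
have := ler_wpM2l (normr_ge0 (complex.Im z)) h1; lra.
Qed.

Lemma ocone_sector z : ocone tau z -> exists2 kappa : R, 0 <= kappa &
  forall f y, B (f, y) -> `|complex.Im (dot (z *: y) f)| <=
    kappa * complex.Re (dot (z *: y) f).
Proof.
move=> zK; set c := complex.Re z - tau * `|complex.Im z|.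
have c0 : 0 < c by rewrite subr_gt0.
have Rez := ocone_Re tau0 zK.
exists ((tau * complex.Re z + `|complex.Im z|) / c).
  by rewrite divr_ge0 ?(ltW c0)// addr_ge0// mulr_ge0// ltW.
move=> f y fy; have := ocone_accr zK fy; rewrite -/c => h.
have h0 := Baccr fy; have h1 := Bsector fy.
rewrite mulrAC ler_pdivlMr//.
rewrite (dotZl dotP) in h *; rewrite cImM.
have h2 : 0 <= tau * complex.Re z + `|complex.Im z|.
  by rewrite addr_ge0// mulr_ge0// ltW.
apply: le_trans (ler_wpM2l h2 h); rewrite mulrA mulrAC ler_pM2r//.
apply: le_trans (ler_normD _ _) _; rewrite !normrM (gtr0_norm Rez).
rewrite (ger0_norm h0).
have := ler_wpM2l (ltW Rez) h1; lra.
Qed.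

Hypothesis Bres : forall l : R[i], 0 < complex.Re l ->
  exists Q : {linear H -> H}, op_inverse (op_addC B l) Q.

(** J z is 1/z times the resolvent of B at - 1/z, and 1/z has a positive real
    part.  It contracts because Re <z B f, f> is nonnegative, so that adding
    z B f to f cannot shorten it. *)
Lemma sectorial_resolvents : exists J, contractive_resolvents B (cone tau) J.
Proof.
have Blin c f y g w : B (f, y) -> B (g, w) -> B (c *: f + g, c *: y + w).
  have [|Q Q1] := @Bres 1; first by rewrite /= ltr01.
  exact: (@op_inverse_linear _ _ _ _ _ c f y g w Q1).
have Kex z : exists J : {linear H -> H}, (z = 0 -> forall f, J f = f) /\
    (z != 0 -> cone tau z ->
    (forall g, exists y, B (J g, y) /\ J g + z *: y = g) /\
    (forall f y, B (f, y) -> J (f + z *: y) = f)).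
  have [->|z0] := eqVneq z 0; first by exists idfun.
  have [zK|nzK] := pselect (ocone tau z); last first.
    by exists idfun; split=> [/eqP|_ [/eqP|//]]; rewrite (negPf z0).
  have [|Q [Q1 Q2]] := @Bres z^-1.
    have := ocone_Re tau0 zK; case: (z) => x y /= x0.
    by rewrite divr_gt0// ltr_pwDl ?sqr_ge0// exprn_gt0.
  have [J JE] : exists J : {linear H -> H}, forall g, J g = Q (z^-1 *: g).
    apply: (@linear_pack _ _ (fun g => Q (z^-1 *: g))) => c f g.
    by rewrite scalerDr scalerA mulrC -scalerA linearP.
  exists J; split=> [/eqP|_ _]; first by rewrite (negPf z0).
  split=> [g|f y fy]; rewrite JE.
    have [[p1 p2] Bp [e1 e2]] := Q1 (z^-1 *: g); rewrite /= in e1 e2.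
    exists p2; rewrite -e1; split=> //.
    move: (congr1 ( *:%R z) e2).
    by rewrite scalerDr !scalerA mulfV// !scale1r addrC.
  rewrite scalerDr scalerA mulVf// scale1r addrC.
  by apply: Q2; exists (f, y).
have [J JP] := choice Kex; exists J; split=> //.
- by move=> f; apply: (JP 0).1.
- by move=> z g Kz z0; have [/(_ g)] := (JP z).2 z0 Kz.
- move=> z f y Kz fy; have [->|z0] := eqVneq z 0.
    by rewrite scale0r addr0 (JP 0).1.
  by have [_] := (JP z).2 z0 Kz; apply.
move=> z f Kz; have [->|z0] := eqVneq z 0; first by rewrite (JP 0).1.
have [/(_ f)[y [fy e]] _] := (JP z).2 z0 Kz.
rewrite -{2}e -(ler_pXn2r (n := 2)) ?nnegrE ?nm_ge0//.
rewrite (nm_sqrD dotP) -addrA lerDl addr_ge0 ?sqr_ge0//.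
rewrite mulr_ge0//; case: Kz => [/eqP|zK]; first by rewrite (negPf z0).
apply: le_trans (ocone_accr zK fy).
by rewrite mulr_ge0 ?Baccr// subr_ge0 ltW.
Qed.

(** After n = 2^k steps of size h = 1 / n the weight (n + 1)^2 h^2 exceeds 1, so
    the energy bounds |v_n|^2 by h^2 |z B f|^2 + M^2 |f|^2; the first term, the
    only one involving B f, disappears in the limit. *)
Lemma sectorial_smoothing J (T : R[i] -> {linear H -> H}) :
  contractive_resolvents B (cone tau) J ->
  (forall z f, cone tau z -> euler J k z f @[k --> \oo] --> T z f) ->
  forall z, ocone tau z -> exists2 c : R, 0 <= c &
    forall f y, B (f, y) -> nm (T z y) <= c * nm f.
Proof.
move=> BJ TE z zK; have Kz : cone tau z by right.
have [kappa kappa0 Pk] := ocone_sector zK.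
pose M := 1 + kappa; have M0 : 0 < M by rewrite ltr_pwDl.
pose P : set (H * H) := [set p | exists2 y, B (p.1, y) & p.2 = z *: y].
have Plin c f y g w : P (f, y) -> P (g, w) -> P (c *: f + g, c *: y + w).
  move=> [y' fy' /= ->] [w' gw' /= ->]; exists (c *: y' + w').
    exact: (res_lin BJ).
  by rewrite /= scalerDr !scalerA mulrC.
have Psector f y : P (f, y) ->
    `|complex.Im (dot y f)| <= kappa * complex.Re (dot y f).
  by move=> [y' fy' /= ->]; exact: Pk.
have Paccr f y : P (f, y) -> 0 <= complex.Re (dot y f).
  move=> [y' fy' /= ->]; apply: le_trans (ocone_accr zK fy').
  by rewrite mulr_ge0 ?Baccr// subr_ge0 ltW.
have z0 : z != 0.
  by apply/eqP => z0; have := ocone_Re tau0 zK; rewrite z0 /= ltxx.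
have nz0 : 0 < normc z.
  rewrite lt_def normc_ge0 andbT; apply: contra z0 => /eqP.
  by move/ComplexField.Normc.eq0_normc ->.
suff smooth f y : B (f, y) -> nm (T z (z *: y)) <= M * nm f.
  exists (M / normc z); first by rewrite divr_ge0 ?ltW.
  move=> f y fy; rewrite mulrAC ler_pdivlMr// mulrC.
  by have := smooth _ _ fy; rewrite linearZ nmZ.
move=> fy; set v := z *: y.
pose h k : R := 2^-1 ^+ k.
have h0 k : 0 < h k by rewrite exprn_gt0// invr_gt0.
have Kh k : cone tau ((h k)%:C * z).
  by apply: (coneZ (cone_convex tau0)) => //; exact: ltW.
have hz0 k : (h k)%:C * z != 0 by rewrite mulf_neq0// gt_eqF// ltcR.
pose Jk k := J ((h k)%:C * z).
have energy k n : (n%:R + 1) ^+ 2 * h k ^+ 2 * nm (iter n (Jk k) v) ^+ 2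
    + M ^+ 2 * nm (iter n (Jk k) f) ^+ 2
    <= h k ^+ 2 * nm v ^+ 2 + M ^+ 2 * nm f ^+ 2.
  elim: n => [|n IHn]; first by rewrite /= add0r expr1n mul1r.
  apply: le_trans IHn.
  have graph m : P (iter m (Jk k) f, iter m (Jk k) v).
    exists (iter m (Jk k) y); first exact: (res_iter_graph BJ).
    by rewrite /v iter_scale.
  have [w' [vw' e]] := res_dom BJ (iter n (Jk k) v) (Kh k) (hz0 k).
  have vw : P (iter n.+1 (Jk k) v, z *: w') by exists w'.
  have := @euler_step_energy _ _ _ dotP _ _ Plin Psector Paccr kappa0
    (h k) (n.+1%:R) _ _ _ (ltW (h0 k)) _ (graph n.+1) vw.
  rewrite -/M ler1n => /(_ isT).
  have -> : iter n.+1 (Jk k) v + (h k)%:C *: (z *: w') = iter n (Jk k) v.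
    by rewrite scalerA.
  have -> : iter n.+1 (Jk k) f + (h k)%:C *: iter n.+1 (Jk k) v =
      iter n (Jk k) f.
    have := res_sub BJ (Kh k) (res_iter_graph BJ n (Kh k) fy).
    move=> /(canRL (subrK _)) /=; rewrite -/(Jk k) => ->.
    rewrite -[Jk k (iter n (Jk k) v)]/(iter n.+1 (Jk k) v) /v.
    rewrite iter_scale scalerA.
    by rewrite addrC addrA subrr add0r.
  by rewrite -natr1.
apply: (@cvg_nm_le _ _ (fun k => euler J k z v)
  (fun k => nm v * h k + M * nm f)) => [||k].
- exact: TE.
- rewrite -[X in _ --> X]add0r; apply: cvgD; last exact: cvg_cst.
  exact: cvg_half.
have := energy k (2 ^ k)%N; rewrite -[iter _ _ v]/(euler J k z v).
have hk := steps_mul R k; rewrite -/(h k) in hk.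
have -> : ((2 ^ k)%:R + 1) ^+ 2 * h k ^+ 2 = (1 + h k) ^+ 2 :> R.
  by rewrite -exprMn mulrDl hk mul1r.
move=> hE; rewrite -(ler_pXn2r (n := 2)) ?nnegrE ?nm_ge0//; last first.
  by rewrite addr_ge0 ?mulr_ge0 ?nm_ge0// ltW.
have h1 := sqr_ge0 (nm (euler J k z v)).
have h2 := mulr_ge0 (ltW (h0 k)) h1.
have h3 := mulr_ge0 (sqr_ge0 (h k)) h1.
have h4 := mulr_ge0 (sqr_ge0 M) (sqr_ge0 (nm (iter (2 ^ k) (Jk k) f))).
have h5 := mulr_ge0 (mulr_ge0 (nm_ge0 v) (ltW (h0 k)))
  (mulr_ge0 (ltW M0) (nm_ge0 f)).
lra.
Qed.

End sectorial_relation.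

(** * The complex exponential *)

Section complex_exponential.
Variable R : realType.
Implicit Types (x y : R) (z v w : R[i]).

Lemma abs_sin_le y : 0 <= y -> `|sin y| <= y.
Proof.
move=> y0; have [c _] := MVT_segment y0
  (fun x _ => is_derive_sin x) (continuous_subspaceT (@continuous_sin R)).
rewrite sin0 !subr0 => ->; rewrite normrM (ger0_norm y0).
by rewrite ler_piMl// ler_norml cos_geN1 cos_le1.
Qed.

Lemma abs_cos_sub1_le y : 0 <= y -> `|cos y - 1| <= y ^+ 2.
Proof.
move=> y0; have [c] := MVT_segment y0
  (fun x _ => is_derive_cos x) (continuous_subspaceT (@continuous_cos R)).
rewrite in_itv /= cos0 subr0 => /andP[c0 cy] ->.
rewrite normrM normrN (ger0_norm y0) expr2 ler_wpM2r//.
by rewrite (le_trans (abs_sin_le c0)).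
Qed.

Lemma abs_sin_sub_le y : 0 <= y -> `|sin y - y| <= y ^+ 3.
Proof.
move=> y0; have [c] := MVT_segment y0
  (fun x _ => is_derive_sin x) (continuous_subspaceT (@continuous_sin R)).
rewrite in_itv /= sin0 !subr0 => /andP[c0 cy] ->.
rewrite -[X in _ - X]mul1r -mulrBl normrM (ger0_norm y0) exprSr ler_wpM2r//.
apply: le_trans (abs_cos_sub1_le c0) _.
by rewrite ler_pXn2r ?nnegrE.
Qed.

Lemma abs_expR_sub_le x : `|x| <= 2^-1 -> `|expR x - 1 - x| <= 2 * x ^+ 2.
Proof.
move=> /ler_normlP[h1 h2].
have h3 := expR_ge1Dx x; have h4 := expR_ge1Dx (- x).
have h5 : expR x * expR (- x) = 1 by rewrite -expRD subrr expR0.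
have h6 := expR_gt0 x.
have h7 := ler_wpM2l (ltW h6) h4; rewrite h5 in h7.
rewrite ler_norml; apply/andP; split.
  by have := sqr_ge0 x; lra.
have h8 : 0 <= 1 - x - 2^-1 by lra.
rewrite lerBlDr lerBlDr.
have x1 : 0 < 1 - x by lra.
rewrite -(ler_pM2r x1); apply: le_trans h7 _.
have := mulr_ge0 (sqr_ge0 x) h8; lra.
Qed.

Definition cexp z : R[i] :=
  (expR (complex.Re z) * cos (complex.Im z)) +i*
  (expR (complex.Re z) * sin (complex.Im z)).

Lemma cexpD z w : cexp (z + w) = cexp z * cexp w.
Proof.
rewrite /cexp cReD cImD expRD cosD sinD; simpc.
by congr (_ +i* _); ring.
Qed.

Lemma cexp0 : cexp 0 = 1.
Proof. by rewrite /cexp /= expR0 cos0 sin0 mulr1 mulr0. Qed.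

Lemma normc_le_parts z : normc z <= `|complex.Re z| + `|complex.Im z|.
Proof.
case: z => x y /=; rewrite -(@ler_pXn2r _ 2) ?nnegrE ?sqrtr_ge0 ?addr_ge0//.
rewrite sqr_sqrtr ?addr_ge0 ?sqr_ge0// -[x ^+ 2]real_normK ?num_real//.
rewrite -[y ^+ 2]real_normK ?num_real//.
have := mulr_ge0 (normr_ge0 x) (normr_ge0 y); lra.
Qed.

Lemma cexp_taylor v : normc v <= 2^-1 ->
  normc (cexp v - 1 - v) <= 8 * normc v ^+ 2.
Proof.
move=> v2; have [h1 h2] := parts_le_normc v.
apply: le_trans (normc_le_parts _) _; move: h1 h2 v2.
have := normc_ge0 v; have [r ->] : exists r : R, normc v = r by eexists.
case: v => x y /=; rewrite !subr0 => r0 xr yr r2.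
have hx := abs_expR_sub_le (le_trans xr r2).
have xx : x ^+ 2 <= r ^+ 2.
  by rewrite -ler_sqrt ?sqr_ge0// !sqrtr_sqr (ger0_norm r0).
have e2 : expR x <= 2.
  move: hx; have := xr; rewrite !ler_norml => /andP[x1 x2] /andP[_ +].
  nra.
have yy : `|y| ^+ 2 <= r ^+ 2 by rewrite ler_pXn2r ?nnegrE.
have e0 := expR_ge0 x.
have cy : `|cos y - 1| <= `|y| ^+ 2.
  have := abs_cos_sub1_le (normr_ge0 y); case: (ger0P y) => //.
  by rewrite cosN.
have sy : `|sin y - y| <= `|y| ^+ 3.
  have := abs_sin_sub_le (normr_ge0 y); case: (ger0P y) => // _.
  by rewrite sinN -opprD normrN.
have P1 : `|expR x * cos y - 1 - x| <= 4 * r ^+ 2.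
  have -> : expR x * cos y - 1 - x = (expR x - 1 - x) + expR x * (cos y - 1).
    by ring.
  apply: le_trans (ler_normD _ _) _; rewrite normrM (ger0_norm e0).
  have := ler_wpM2l e0 (le_trans cy yy).
  have := ler_wpM2r (sqr_ge0 r) e2; lra.
have P2 : `|expR x * sin y - y| <= 4 * r ^+ 2.
  have -> : expR x * sin y - y =
      expR x * (sin y - y) + y * (expR x - 1 - x) + y * x by ring.
  apply: le_trans (ler_normD _ _) _; rewrite normrM.
  apply: (@le_trans _ _ (2 * (r * r ^+ 2) + r * (2 * r ^+ 2) + r * r)).
    apply: lerD; last by apply: ler_pM.
    apply: le_trans (ler_normD _ _) _; rewrite !normrM; apply: lerD.
      apply: ler_pM => //; first by rewrite ger0_norm.
      by apply: le_trans sy _; rewrite exprS ler_pM ?sqr_ge0.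
    apply: ler_pM => //; apply: le_trans hx _; lra.
  have : r * r ^+ 2 <= 2^-1 * r ^+ 2 by rewrite ler_wpM2r ?sqr_ge0.
  have := sqr_ge0 r.
  lra.
lra.
Qed.

Lemma nm_normc z : nm (z : R[i]) = normc z.
Proof. by []. Qed.

Lemma cexp_continuous : continuous cexp.
Proof.
move=> z; apply/(@cvg_nmP _ _ _ (nbhs z)) => e e0.
have c0 : 0 < 1 + normc (cexp z) * 5 by rewrite ltr_pwDl// mulr_ge0 ?normc_ge0.
have : (id : R[i] -> R[i]) w @[w --> z] --> z by [].
move=> /(@cvg_nmP _ _ _ (nbhs z)) h.
have r0 : 0 < Num.min 2^-1 (e / (1 + normc (cexp z) * 5)) by
  rewrite lt_min invr_gt0 ltr0n divr_gt0.
move: (h _ r0); apply: filterS => w; rewrite le_min => /andP[h1 h2].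
rewrite nm_distC nm_normc in h1; rewrite nm_distC nm_normc in h2.
rewrite nm_distC nm_normc -/(cexp w).
have -> : cexp w - cexp z = cexp z * (cexp (w - z) - 1).
  by rewrite mulrBr mulr1 -cexpD (addrC z) subrK.
rewrite ComplexField.Normc.normcM.
have h3 := cexp_taylor h1.
have h4 := ler_normcD (cexp (w - z) - 1 - (w - z)) (w - z).
rewrite subrK in h4.
have h5 : normc (cexp (w - z) - 1) <= 5 * normc (w - z).
  have := normc_ge0 (w - z); nra.
move: h2; rewrite ler_pdivlMr// => h2.
have := ler_wpM2l (normc_ge0 (cexp z)) h5.
have := normc_ge0 (w - z); lra.
Qed.

Lemma real_complex_continuous : continuous (fun t : R => t%:C : R[i]).
Proof.
move=> t; apply/(@cvg_nmP _ _ _ (nbhs t)) => e e0.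
have /(@cvgrPdist_le _ _ _ (nbhs t)) : (id : R -> R) s @[s --> t] --> t by [].
move=> /(_ _ e0); apply: filterS => s.
by rewrite -rmorphB nm_normc normcR.
Qed.

Lemma cexp_real t : cexp t%:C = (expR t)%:C.
Proof. by rewrite /cexp /= cos0 sin0 mulr1 mulr0. Qed.

End complex_exponential.

(** * From arguments to the cone *)

Section sector.
Variable R : realType.

(** With alpha = Arg z, the claim tan theta |sin alpha| < cos alpha amounts to
    cos (|alpha| + theta) > 0. *)
Lemma open_sector_ocone (theta : R) (z : R[i]) : 0 <= theta < pi / 2 ->
  open_sector (pi / 2 - theta) z -> ocone (tan theta) z.
Proof.
move=> /andP[t0 tp] [z0 Az]; have [_ zE] := ArgP z0.
have r0 : 0 < normc z.
  rewrite lt_def normc_ge0 andbT; apply: contra z0 => /eqP.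
  by move/ComplexField.Normc.eq0_normc ->.
have ct : 0 < cos theta.
  apply: cos_gt0_pihalf; rewrite tp (lt_le_trans _ t0)// oppr_lt0.
  by rewrite divr_gt0 ?pi_gt0.
rewrite /ocone /= zE cReM cImM /= !mul0r subr0 addr0.
rewrite normrM gtr0_norm// mulrCA ltr_pM2l//.
rewrite /tan mulrAC ltr_pdivrMr//.
set al := Arg z in Az *.
have aE : cos al = cos `|al| by case: (ger0P al) => // _; rewrite cosN.
have sE : `|sin al| <= `|sin `|al| |.
  by case: (ger0P al) => // _; rewrite sinN normrN.
have sp : 0 <= sin `|al|.
  apply: sin_ge0_pi; rewrite normr_ge0/=.
  have := pi_gt0 R; lra.
rewrite (ger0_norm sp) in sE.
have : 0 < cos (`|al| + theta).
  apply: cos_gt0_pihalf; have := pi_gt0 R; have := normr_ge0 al; lra.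
rewrite cosD -aE.
have st : 0 <= sin theta by apply: sin_ge0_pi; have := pi_gt0 R; lra.
have := ler_wpM2l st sE; lra.
Qed.

End sector.

(** * Generators and derivatives *)

Section rescaled_generator.
Variables (R : realType) (H : normedModType R[i]).
Implicit Types (S : R -> H -> H) (f p : H).

(** The limit that defines the generator at f. *)
Definition orbit_derivative S f p :=
  (t^-1)%:C *: (S t f - f) @[t --> 0^'+] --> p.

Lemma expR_derivative0 (c : R) :
  ((t^-1)%:C * ((expR (c * t))%:C - 1) : R[i]) @[t --> 0^'+] --> c%:C.
Proof.
apply/cvg_nmP => e e0.
pose d := Num.min (2^-1 / (1 + `|c|)) (e / (1 + 8 * c ^+ 2)).
have c1 : 0 < 1 + `|c| by rewrite ltr_pwDl.
have c2 : 0 < 1 + 8 * c ^+ 2 by rewrite ltr_pwDl// mulr_ge0 ?sqr_ge0.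
have d0 : 0 < d by rewrite lt_min !divr_gt0 ?invr_gt0.
near=> t; have t0 : 0 < t by near: t; exact: nbhs_right_gt.
have td : t <= d by near: t; exact: nbhs_right_le.
move: td; rewrite le_min !ler_pdivlMr// => /andP[t1 t2].
rewrite nm_distC nm_normc.
have -> : (t^-1)%:C * ((expR (c * t))%:C - 1) - c%:C =
    (t^-1)%:C * (cexp (c * t)%:C - 1 - (c * t)%:C).
  have ht : (t^-1)%:C * (c * t)%:C = c%:C :> R[i].
    by rewrite -rmorphM mulrCA mulVf ?mulr1 ?gt_eqF.
  by rewrite cexp_real [in RHS]mulrBr ht.
rewrite ComplexField.Normc.normcM normcR gtr0_norm ?invr_gt0//.
rewrite mulrC ler_pdivrMr//.
have nE : normc (c * t)%:C = `|c| * t by rewrite normcR normrM (gtr0_norm t0).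
apply: le_trans (cexp_taylor _) _; rewrite nE; first by nra.
rewrite exprMn real_normK ?num_real//.
have := sqr_ge0 c; nra.
Unshelve. all: by end_near. Qed.

Lemma orbit_derivative_expR S f p (c : R) : orbit_derivative S f p ->
  orbit_derivative (fun t f => (expR (c * t))%:C *: S t f) f (p + c%:C *: f).
Proof.
move=> Sp; rewrite /orbit_derivative.
rewrite (_ : (fun t => _) = (fun t => (expR (c * t))%:C *:
    ((t^-1)%:C *: (S t f - f)) + ((t^-1)%:C * ((expR (c * t))%:C - 1)) *: f)).
  apply: cvgD; last by apply: cvgZr_tmp; exact: expR_derivative0.
  rewrite -[X in _ --> X]scale1r; apply: cvgZ => //.
  rewrite -(_ : (expR (c * 0))%:C = 1); last by rewrite mulr0 expR0.
  apply: (@cvg_comp _ _ _ (fun t : R => expR (c * t)) (fun x : R => x%:C : R[i])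
     _ (nbhs (expR (c * 0)))); last exact: real_complex_continuous.
  apply: cvg_within_filter.
  apply: (@cvg_comp _ _ _ (fun t : R => c * t) expR _ (nbhs (c * 0))).
    by apply: cvgMr; exact: cvg_id.
  exact: continuous_expR.
apply/funext => t; set E := (expR _)%:C; set x := S t f.
rewrite (scalerA E) (mulrC E) -!scalerA -scalerDr; congr (_ *: _).
by rewrite scalerBr scalerBl scale1r addrA subrK.
Qed.

End rescaled_generator.

Section orbits.
Variables (R : realType) (H : normedModType R[i]).
Variables (B : set (H * H)) (K : set R[i]) (J T : R[i] -> {linear H -> H}).
Hypotheses (BJ : contractive_resolvents B K J) (KC : convex_cone K).
Hypothesis Bd : dense_set [set f | exists y, B (f, y)].
Hypothesis TE : forall z f, K z -> euler J k z f @[k --> \oo] --> T z f.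

Let Kt (t : R) : 0 <= t -> K t%:C.
Proof. by move=> t0; exact: (coneR KC). Qed.

Lemma sg_orbit_continuous f (t : R) : 0 <= t ->
  T s%:C f @[s --> within [set t : R | 0 <= t] (nbhs t)] --> T t%:C f.
Proof.
move=> t0.
apply/cvg_nmP => e e0.
have [d d0 dP] := sg_cvg0 BJ KC Bd TE f e0.
have near_step r s : 0 <= r -> r <= s -> s - r <= d ->
    nm (T s%:C f - T r%:C f) <= e.
  move=> r0 rs sr; have sr0 : 0 <= s - r by rewrite subr_ge0.
  have -> : s%:C = r%:C + (s - r)%:C :> R[i] by rewrite -rmorphD subrKC.
  rewrite (sg_mul BJ KC Bd TE _ (Kt r0) (Kt sr0)) -linearB.
  apply: le_trans (sg_contr BJ KC TE _ (Kt r0)) _.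
  by apply: dP; [exact: Kt|rewrite normcR ger0_norm].
rewrite near_withinE.
have /(@cvgrPdist_le _ _ _ (nbhs t)) : (id : R -> R) s @[s --> t] --> t by [].
move=> /(_ _ d0); apply: filterS => s /= ts s0.
have [st|/ltW st] := leP s t.
  by apply: near_step => //; rewrite (le_trans (ler_norm _)).
rewrite nm_distC; apply: near_step => //.
by rewrite (le_trans (ler_norm _))// distrC.
Qed.

Lemma sg_orbit_derivative f y : B (f, y) ->
  orbit_derivative (fun t => T t%:C) f (- y).
Proof.
move=> fy; apply/cvg_nmP => e e0.
have [d d0 dP] := sg_derive0 BJ KC Bd TE fy e0.
near=> t; have t0 : 0 < t by near: t; exact: nbhs_right_gt.
have td : t <= d by near: t; exact: nbhs_right_le.
have := dP t%:C (Kt (ltW t0)); rewrite normcR gtr0_norm// => /(_ td) h.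
rewrite -nmN opprB opprK addrC.
have -> : y + (t^-1)%:C *: (T t%:C f - f) =
    (t^-1)%:C *: (T t%:C f - f + t%:C *: y).
  by rewrite [RHS]scalerDr scalerA -rmorphM mulVf ?gt_eqF// scale1r addrC.
by rewrite nmZR gtr0_norm ?invr_gt0// mulrC ler_pdivrMr.
Unshelve. all: by end_near. Qed.

(** The generator of a contraction semigroup cannot extend - B strictly: with
    g = J 1 (f - p) the vector u = f - g satisfies u = d/dt T t u at t = 0, so
    that |T t u| would grow like (1 + t) |u| if u were not 0. *)
Lemma sg_generator_sub f p : orbit_derivative (fun t => T t%:C) f p ->
  B (f, - p).
Proof.
move=> fp; have K1 := cone1 KC.
have [y [gy]] := res_dom BJ (f - p) K1 (oner_neq0 _).
set g := J 1 (f - p) => e; rewrite scale1r in e.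
have up : orbit_derivative (fun t => T t%:C) (f - g) (f - g).
  have yE : p - - y = f - g.
    have yE : y = f - p - g by rewrite -e addrC addKr.
    by rewrite opprK yE addrA [p + _]addrC subrK.
  rewrite -[X in orbit_derivative _ _ X]yE /orbit_derivative.
  rewrite (_ : (fun t => _) = (fun t => (t^-1)%:C *: (T t%:C f - f) -
      (t^-1)%:C *: (T t%:C g - g))).
    by apply: cvgB => //; exact: sg_orbit_derivative.
  apply/funext => t; rewrite (linearB (T t%:C)) -scalerBr; congr (_ *: _).
  by rewrite !opprB !addrA [RHS](ACl (1*4*3*2)).
have fg : f - g = 0.
  apply: nm_eq0; apply/eqP; rewrite eq_le nm_ge0 andbT.
  apply/ler_addgt0Pr => e' e0; rewrite add0r.
  set u := f - g in up *.
  move/cvg_nmP/(_ _ e0): up => h; near (0 : R)^'+ => t.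
  have t0 : 0 < t by near: t; exact: nbhs_right_gt.
  have : nm (u - (t^-1)%:C *: (T t%:C u - u)) <= e' by near: t.
  have := sg_contr BJ KC TE u (Kt (ltW t0)).
  set v := u - _ => h1 h2.
  have Tu : T t%:C u + t%:C *: v = (1 + t)%:C *: u.
    rewrite /v (scalerBr t%:C) scalerA -rmorphM mulfV ?gt_eqF// scale1r.
    rewrite rmorphD scalerDl scale1r opprB addrC -addrA [u - _ + _]subrK.
    by rewrite addrC.
  have h3 := nmD (T t%:C u) (t%:C *: v).
  rewrite Tu !nmZR !ger0_norm ?(ltW t0)// in h3; last first.
    by rewrite addr_ge0// ltW.
  have h4 : t * nm u <= t * nm v by lra.
  by rewrite ler_pM2l// in h4; apply: le_trans h4 h2.
have gf : g = f by apply/esym/eqP; rewrite -subr_eq0 fg.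
have yp : y = - p by apply: (addrI g); rewrite e gf.
by rewrite -yp -gf.
Unshelve. all: by end_near. Qed.

(** Multiplication by exp (- a z) preserves second-order Taylor bounds in
    operator norm; D is the derivative of T at z, D' that of the product. *)
Lemma rescaled_taylor (a c r : R) z (D : {linear H -> H}) :
  K z -> 0 <= c -> 0 < r -> (forall f, nm (D f) <= c * nm f) ->
  (forall v, normc v <= r -> K (z + v) /\ forall f,
     nm (T (z + v) f - T z f - v *: D f) <= c ^+ 2 * normc v ^+ 2 * nm f) ->
  exists (D' : {linear H -> H}) (C r' : R),
    [/\ exists c', forall f, nm (D' f) <= c' * nm f, 0 < r' &
     forall v f, normc v <= r' ->
       nm (cexp (- a%:C * (z + v)) *: T (z + v) f - cexp (- a%:C * z) *: T z f
           - v *: D' f) <= C * normc v ^+ 2 * nm f].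
Proof.
move=> Kz c0 r0 Dc DT.
have [D' DE] : exists D' : {linear H -> H}, forall f,
    D' f = cexp (- a%:C * z) *: (D f - a%:C *: T z f).
  by exists (cexp (- a%:C * z) \*: (D \- (a%:C \*: T z))).
pose M := normc (cexp (- a%:C * z)).
have M0 : 0 <= M by exact: normc_ge0.
exists D', (M * (c ^+ 2 + 8 * a ^+ 2 + `|a| * (c ^+ 2 + c))),
  (Num.min r (Num.min 1 (2^-1 / (1 + `|a|)))).
have a1 : 0 < 1 + `|a| by rewrite ltr_pwDl.
have r1 : 0 < Num.min r (Num.min 1 (2^-1 / (1 + `|a|))).
  by rewrite !lt_min r0 ltr01 divr_gt0.
split=> //; first exists (M * (c + `|a|)).
  move=> f; rewrite DE nmZ -/M -mulrA ler_wpM2l//.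
  apply: le_trans (nmB _ _) _; rewrite nmZR mulrDl; apply: lerD => //.
  by rewrite ler_wpM2l// (sg_contr BJ KC TE).
move=> v f; rewrite !le_min ler_pdivlMr// => /and3P[vr v1 va].
have [Kzv DP] := DT _ vr; have := DP f.
set X := T (z + v) f; set Y := T z f => h.
have XX : nm X <= nm f by exact: (sg_contr BJ KC TE).
have Df := Dc f.
have -> : cexp (- a%:C * (z + v)) *: X - cexp (- a%:C * z) *: Y
    - v *: D' f = cexp (- a%:C * z) *:
    ((X - Y - v *: D f) + (cexp (- a%:C * v) - 1 - (- a%:C * v)) *: X
     - (a%:C * v) *: (X - Y)).
  rewrite DE -/Y mulrDr cexpD -scalerA (scalerA v) (mulrC v).
  rewrite -(scalerA _ v) -!scalerBr; congr (_ *: _).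
  rewrite mulNr opprK scalerDl scalerBl scale1r (scalerBr (a%:C * v)).
  rewrite (scalerBr v) (scalerA v) (mulrC v) !opprB !addrA.
  by rewrite [RHS](ACl (4*2*7*3*(1*5)*(6*8)))/= !subrr !addr0.
have avE : normc (- a%:C * v) = `|a| * normc v.
  by rewrite ComplexField.Normc.normcM -rmorphN normcR normrN.
have av2 : normc (- a%:C * v) <= 2^-1 by rewrite avE; have := normc_ge0 v; lra.
have := cexp_taylor av2; rewrite avE => hE.
have XY : nm (X - Y) <= c ^+ 2 * normc v ^+ 2 * nm f + normc v * (c * nm f).
  rewrite -(subrK (v *: D f) (X - Y)) (le_trans (nmD _ _))// nmZ lerD//.
  by rewrite ler_wpM2l ?normc_ge0.
rewrite nmZ -/M -!mulrA ler_wpM2l//.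
apply: le_trans (nmB _ _) _; apply: le_trans (lerD (nmD _ _) (lexx _)) _.
rewrite !nmZ ComplexField.Normc.normcM normcR.
have n0 := normc_ge0 v; have F0 := nm_ge0 f; have a0 := normr_ge0 a.
have hEX := ler_pM (normc_ge0 _) (nm_ge0 X) hE XX.
have hXY := ler_wpM2l (mulr_ge0 a0 n0) XY.
have v10 : 0 <= 1 - normc v by rewrite subr_ge0.
have := mulr_ge0 (mulr_ge0 (mulr_ge0 a0 (sqr_ge0 c)) F0)
  (mulr_ge0 (sqr_ge0 (normc v)) v10).
have aE : a ^+ 2 = `|a| ^+ 2 by rewrite real_normK ?num_real.
rewrite aE; move: h hEX hXY; lra.
Qed.

End orbits.

Section holomorphy.
Variables (R : realType) (H : normedModType R[i]).

Lemma near0_normc_le (d : R) : 0 < d ->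
  \forall w \near (0 : R[i]), normc w <= d.
Proof.
have /(@cvg_nmP _ _ _ (nbhs (0 : R[i]))) h :
  (id : R[i] -> R[i]) s @[s --> 0] --> 0 by [].
by move=> /h; apply: filterS => w; rewrite sub0r nmN.
Qed.

(** A remainder that is quadratic in v, uniformly on bounded sets, is more than
    complex differentiability asks for. *)
Lemma quadratic_holomorphic (S : set R[i]) (Z : R[i] -> {linear H -> H}) :
  (forall z, S z -> exists (D : {linear H -> H}) (C r : R),
    [/\ exists c, forall f, nm (D f) <= c * nm f, 0 < r &
     forall v f, normc v <= r ->
       nm (Z (z + v) f - Z z f - v *: D f) <= C * normc v ^+ 2 * nm f]) ->
  holomorphic_on S Z.
Proof.
move=> SZ z /SZ[D [C [r [[c Dc] r0 DP]]]]; exists D.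
split; first exact: bounded_continuous Dc.
move=> e e0; have [d d0 dP] := ball_pos e0 (normr_ge0 C).
have dr0 : 0 < Num.min d r by rewrite lt_min d0.
have h := nbhs_dnbhs (near0_normc_le dr0); near=> w.
have w0 : w != 0 by near: w; exact: nbhs_dnbhs_neq.
have : normc w <= Num.min d r by near: w.
rewrite le_min => /andP[wd wr] f.
have nw0 : 0 < normc w.
  rewrite lt_def normc_ge0 andbT; apply: contra w0 => /eqP.
  by move/ComplexField.Normc.eq0_normc ->.
rewrite !nmE -rmorphM lecR.
have -> : w^-1 *: (Z (z + w) f - Z z f) - D f =
    w^-1 *: (Z (z + w) f - Z z f - w *: D f).
  by rewrite [RHS]scalerBr scalerA mulVf// scale1r.
rewrite nmZ ComplexField.Normc.normcV mulrC ler_pdivrMr//.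
apply: le_trans (DP _ _ wr) _.
have := dP (normc w); rewrite normc_ge0 wd => /(_ isT) h1.
have h2 : normc w * C <= e.
  by apply: le_trans h1; rewrite ler_wpM2l ?normc_ge0 ?ler_norm.
have := ler_wpM2r (mulr_ge0 (ltW nw0) (nm_ge0 f)) h2; lra.
Unshelve. all: by end_near. Qed.

End holomorphy.

(** * Generation of a holomorphic semigroup *)

Section holomorphic_generation.
Variables (R : realType) (H : normedModType R[i]) (dot : H -> H -> R[i]).
Hypothesis dotP : inner_product dot.
Hypothesis Hc : cauchy_complete H.
Variables (A : set (H * H)) (a theta : R).
Hypothesis theta_range : 0 <= theta < pi / 2.
Hypothesis Ad : dense_set [set f | exists y, A (f, y)].

Let B := op_addC A (- a%:C).
Let tau := tan theta.
Let K := cone tau.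

Hypothesis Bsector : forall f y, B (f, y) ->
  `|complex.Im (dot y f)| <= tau * complex.Re (dot y f).
Hypothesis Baccr : forall f y, B (f, y) -> 0 <= complex.Re (dot y f).
Hypothesis Bres : forall l : R[i], 0 < complex.Re l ->
  exists Q : {linear H -> H}, op_inverse (op_addC B l) Q.

(** With T the semigroup of - B, the witness is z |-> exp (- a z) T z: the
    factor exp (- a z) has derivative - a at 0, which turns - B into - A. *)
Lemma sectorial_generates :
  generates_holomorphic_semigroup (op_opp A) (pi / 2 - theta).
Proof.
have tau0 : 0 <= tau.
  have := pi_gt0 R; rewrite /tau /tan => pi0; move/andP: theta_range => [h1 h2].
  rewrite divr_ge0//; first by apply: sin_ge0_pi; lra.
  by apply: cos_ge0_pihalf; lra.
have [J BJ] := sectorial_resolvents dotP tau0 Bsector Baccr Bres.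
have KC : convex_cone K := cone_convex tau0.
have Bd : dense_set [set f | exists y, B (f, y)].
  move=> f e e0; have [g [y gy] fg] := Ad f e0; exists g => //.
  by exists (y - a%:C *: g); exists (g, y) => //=; rewrite scaleNr.
have [T TE] := euler_limit BJ KC Hc Bd.
have smooth := sectorial_smoothing dotP tau0 Bsector Baccr BJ TE.
have Ko z : ocone tau z -> K z by right.
have So z : open_sector (pi / 2 - theta) z -> ocone tau z.
  exact: open_sector_ocone.
have Kt (t : R) : 0 <= t -> K t%:C by move=> t0; exact: (coneR KC).
have [Z ZE] : exists Z : R[i] -> {linear H -> H},
    forall z f, Z z f = cexp (- a%:C * z) *: T z f.
  by exists (fun z => cexp (- a%:C * z) \*: T z).
have ZR t f : Z t%:C f = (expR (- a * t))%:C *: T t%:C f.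
  by rewrite ZE -rmorphN -rmorphM cexp_real.
have Zb z : K z -> continuous (Z z).
  move=> Kz; apply: (@bounded_continuous _ _ _ (normc (cexp (- a%:C * z)))).
  by move=> f; rewrite ZE nmZ ler_wpM2l ?normc_ge0// (sg_contr BJ KC TE).
have ZM z w f : K z -> K w -> Z (z + w) f = Z z (Z w f).
  move=> Kz Kw; rewrite !ZE linearZ scalerA mulrDr cexpD.
  by rewrite (sg_mul BJ KC Bd TE).
have Z0 f : Z 0%:C f = f.
  by rewrite ZR mulr0 expR0 scale1r (sg0 BJ KC TE).
have ec (z : R[i]) : cexp (- a%:C * w) @[w --> z] --> cexp (- a%:C * z).
  apply: (@cvg_comp _ _ _ (fun w => - a%:C * w) (@cexp R) _
    (nbhs (- a%:C * z))).
    exact: (@mulrl_continuous _ (- a%:C) z).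
  exact: cexp_continuous.
have gT := sg_orbit_derivative BJ KC Bd TE.
have gTinv := sg_generator_sub BJ KC Bd TE.
exists (fun t => Z t%:C), Z; split=> //.
- split=> [t t0|f|s t f s0 t0|f].
  + exact/Zb/Kt.
  + exact: Z0.
  + by rewrite rmorphD ZM//; exact: Kt.
  apply/subspace_continuousP => t /= t0.
  rewrite (_ : (fun s => _) =
    (fun s => (expR (- a * s))%:C *: T s%:C f)); last first.
    by apply/funext => s; rewrite ZR.
  rewrite /from_subspace; apply: cvgZ.
    apply: cvg_within_filter.
    apply: (@cvg_comp _ _ _ (fun s : R => expR (- a * s))
      (fun x : R => x%:C : R[i]) _ (nbhs (expR (- a * t)))); last first.
      exact: real_complex_continuous.
    apply: (@cvg_comp _ _ _ (fun t : R => - a * t) expR _ (nbhs (- a * t))).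
      by apply: cvgMr; exact: cvg_id.
    exact: continuous_expR.
  exact: (sg_orbit_continuous BJ KC Bd TE).
- apply/seteqP; split=> -[f p] /=; rewrite /semigroup_generator /=.
    move=> fp; have h : orbit_derivative (fun t => T t%:C) f (p + a%:C *: f).
      rewrite /orbit_derivative.
      have := @orbit_derivative_expR _ _ (fun t => Z t%:C) f p a fp.
      rewrite /orbit_derivative.
      rewrite (_ : (fun t => _) = (fun t => (t^-1)%:C *: (T t%:C f - f)))//.
      apply/funext => t; rewrite ZR scalerA -rmorphM -expRD mulNr subrr expR0.
      by rewrite scale1r.
    have [[f' y] fy [/= e1 e2]] := gTinv _ _ h.
    rewrite e1 opprD scaleNr in fy e2.
    by exists (f, y) => //=; rewrite (addIr _ e2) opprK.
  move=> [[f' y] fy [<- <-]] /=.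
  have fB : B (f', y - a%:C *: f') by exists (f', y) => //=; rewrite scaleNr.
  have := @orbit_derivative_expR _ _ (fun t => T t%:C) f' _ (- a) (gT _ _ fB).
  rewrite /orbit_derivative.
  rewrite opprB rmorphN scaleNr addrAC subrr sub0r.
  by under eq_fun do rewrite -ZR.
- by move=> z /So/Ko/Zb.
split.
- apply: quadratic_holomorphic => z /So zK.
  (* [sg_differentiable] takes the derivative at 4 b. *)
  pose b := (4^-1)%:C * z.
  have bb : b + b + (b + b) = z.
    rewrite -[in RHS](mul1r z) /b -!mulrDl -!rmorphD; congr (_%:C * _).
    by lra.
  have bo : ocone tau b by exact: oconeZ.
  have bbo : ocone tau (b + b) by exact: oconeD.
  have [c c0 cP] := smooth b bo.
  have [D [Dc DP]] := sg_differentiable BJ KC Hc Bd TE (Ko b bo) c0 cP.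
  have [r r0 rP] := ocone_open tau0 bbo.
  have [] := @rescaled_taylor _ _ _ _ _ _ BJ KC TE a c r z D (Ko z zK) c0 r0 Dc.
    move=> v vr; have vo := rP _ vr; split=> [|f].
      by apply: Ko; rewrite -bb addrAC; exact: oconeD.
    have := DP v f (Ko _ vo); rewrite bb.
    by have -> : b + b + v + (b + b) = z + v by rewrite addrAC bb.
  move=> D' [C [r' [D'c r'0 D'P]]]; exists D', C, r'; split=> // v f.
  by rewrite !ZE; exact: D'P.
- by move=> z w f /So/Ko Kz /So/Ko Kw; exact: ZM.
- move=> psi f /andP[psi0 psip].
  have e1 : cexp (- a%:C * w) @[w --> (0 : R[i])] --> (1 : R[i]).
    by have := ec 0; rewrite mulr0 cexp0.
  rewrite (_ : (fun z => _) =
    (fun z => cexp (- a%:C * z) *: T z f)); last first.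
    by apply/funext => z; rewrite ZE.
  rewrite -[X in _ --> X]scale1r; apply: cvgZ.
    by apply: cvg_within_filter; exact: e1.
  apply/cvg_nmP => e e0.
  have [d d0 dP] := sg_cvg0 BJ KC Bd TE f e0.
  rewrite near_withinE.
  have := near0_normc_le d0; apply: filterS => z zd [z0 Az].
  rewrite nm_distC; apply: dP => //; apply/Ko/So; split=> //.
  exact: le_lt_trans psip.
Qed.

End holomorphic_generation.

(** * The Hilbert space of weighted square-summable functions *)

#[local] Existing Instance totally_filter.

Section l2_sums.
Variables (R : realType) (V : countType) (m : V -> {posnum R}).
Implicit Types (f g : l2 m) (X Y : {fset V}).

Lemma nm_l2 f : nm f = l2_norm m f. Proof. by []. Qed.

(** Partial sums of the squared norm.  They are real and monotone in the set of
    vertices, which settles all the convergence questions below. *)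
Definition mass (f : V -> R[i]) X : R :=
  \sum_(x <- X) (m x)%:num * normc (f x) ^+ 2.

Lemma mass_fsum (f : V -> R[i]) X :
  (\sum_(x \in [set` X]) ((m x)%:num * normc (f x) ^+ 2)%:E)%E = (mass f X)%:E.
Proof. by rewrite fsumEFin// fsbig_finite// set_fsetK. Qed.

Lemma mass_le f X : mass f X <= nm f ^+ 2.
Proof.
rewrite -lee_fin l2_normK ?l2P// -mass_fsum.
by apply: esum_ge; exists [set` X].
Qed.

Lemma mass_le_l2 (f : V -> R[i]) (s : R) : 0 <= s ->
  (forall X, mass f X <= s ^+ 2) -> f \in l2_pred m /\ l2_norm m f <= s.
Proof.
move=> s0 fs; apply: l2_le => //; apply: ge_ereal_sup => _ [D [finD _] <-].
have := mass_fsum f (fset_set D); rewrite fset_setK// => ->.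
by rewrite lee_fin.
Qed.

Lemma mass_mono (f : V -> R[i]) X Y : (X `<=` Y)%fset -> mass f X <= mass f Y.
Proof.
move=> XY; rewrite -lee_fin -!mass_fsum.
apply: lee_fsum_nneg_subset => //.
  by move=> x /set_mem Xx; apply/mem_set; exact: (fsubsetP XY).
by move=> x _; rewrite lee_fin mulr_ge0// sqr_ge0.
Qed.

Lemma mass_approx f (e : R) : 0 < e -> exists X, nm f ^+ 2 - e <= mass f X.
Proof.
move=> e0; have fin : l2_esum m f \is a fin_num.
  by rewrite -l2_normK ?l2P.
have [_ [D [finD _] <-]] := ub_ereal_sup_adherent e0 fin.
rewrite -[X in (X - _)%E]/(l2_esum m f) -l2_normK ?l2P// => h.
exists (fset_set D).
rewrite -lee_fin EFinB -mass_fsum fset_setK//; exact: ltW.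
Qed.

Lemma mass_cvg f : (mass f X)%:C @[X --> totally] --> ((nm f ^+ 2)%:C : R[i]).
Proof.
apply/cvg_nmP => e e0; have [X0 hX] := mass_approx f e0.
exists X0 => // X /= /(mass_mono f) h.
rewrite -rmorphB nm_normc normcR ger0_norm ?subr_ge0 ?mass_le//; lra.
Qed.

Lemma polarization (z w : R[i]) : z * w^* = (4^-1)%:C *
  ((normc (z + w) ^+ 2)%:C - (normc (z - w) ^+ 2)%:C +
   'i * ((normc (z + 'i * w) ^+ 2)%:C - (normc (z - 'i * w) ^+ 2)%:C)).
Proof.
case: z w => [a b] [c d]; rewrite /normc !sqr_sqrtr ?addr_ge0 ?sqr_ge0//.
by simpc; congr (_ +i* _); field.
Qed.

Lemma polarization_scale (c q z1 z2 z3 z4 : R) : c%:C * (q%:C *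
  (z1%:C - z2%:C + 'i * (z3%:C - z4%:C))) = q%:C *
  ((c * z1)%:C - (c * z2)%:C + 'i * ((c * z3)%:C - (c * z4)%:C)) :> R[i].
Proof. by rewrite !rmorphM; ring. Qed.

Definition dot_psum f g :=
  partial_sum (fun x => ((m x)%:num)%:C * (f x * (g x)^*)).

Lemma dot_psumE f g X : dot_psum f g X = (4^-1)%:C *
  ((mass (l2_fun (f + g)) X)%:C - (mass (l2_fun (f - g)) X)%:C +
   'i * ((mass (l2_fun (f + 'i *: g)) X)%:C
         - (mass (l2_fun (f - 'i *: g)) X)%:C)).
Proof.
rewrite /dot_psum /partial_sum -(big_seq_fsetE _ X predT
  (fun x => ((m x)%:num)%:C * (f x * (g x)^*))) /=.
rewrite /mass !rmorph_sum -!sumrB mulr_sumr -big_split mulr_sumr /=.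
apply: eq_bigr => x _; rewrite polarization; exact: polarization_scale.
Qed.

(** By polarization the partial sums of the scalar product are combinations of
    partial sums of four squared norms. *)
Lemma dot_psum_cvg f g : dot_psum f g @ totally --> l2_dot f g.
Proof.
suff : cvg (dot_psum f g @ totally) by [].
apply/cvg_ex; exists ((4^-1)%:C *
  ((nm (f + g) ^+ 2)%:C - (nm (f - g) ^+ 2)%:C +
   'i * ((nm (f + 'i *: g) ^+ 2)%:C - (nm (f - 'i *: g) ^+ 2)%:C))).
rewrite (_ : dot_psum f g = (fun X => (4^-1)%:C *
  ((mass (l2_fun (f + g)) X)%:C - (mass (l2_fun (f - g)) X)%:C +
   'i * ((mass (l2_fun (f + 'i *: g)) X)%:C
         - (mass (l2_fun (f - 'i *: g)) X)%:C)))).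
  have cB (u v : l2 m) : ((mass u X)%:C - (mass v X)%:C : R[i])
      @[X --> totally] --> ((nm u ^+ 2)%:C - (nm v ^+ 2)%:C : R[i]).
    exact: (cvgB (@mass_cvg u) (@mass_cvg v)).
  exact: (cvgMl_tmp (cvgD (cB _ _) (cvgMl_tmp (cB _ _)))).
by apply/funext => X; rewrite dot_psumE.
Qed.

Lemma conjc_continuous : continuous (@conjc R).
Proof.
move=> z; apply/(@cvg_nmP _ _ _ (nbhs z)) => e e0.
have : (id : R[i] -> R[i]) w @[w --> z] --> z by [].
move=> /(@cvg_nmP _ _ _ (nbhs z)) /(_ _ e0); apply: filterS => w.
by rewrite !nm_normc -rmorphB; case: (z - w) => x y /=; rewrite sqrrN.
Qed.

Lemma l2_inner_product : inner_product (@l2_dot R V m).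
Proof.
have hs := @norm_hausdorff _ R[i].
split=> [c f g h|f g|f].
- apply: (cvg_unique hs (@dot_psum_cvg (c *: f + g) h)).
  rewrite (_ : dot_psum _ _ = (fun X => c * dot_psum f h X + dot_psum g h X)).
    apply: cvgD; [apply: cvgMl_tmp|]; exact: dot_psum_cvg.
  apply/funext => X; rewrite /dot_psum /partial_sum mulr_sumr -big_split.
  by apply: eq_bigr => x _; rewrite /= mulrDl mulrDr -mulrA mulrCA.
- apply: (cvg_unique hs (@dot_psum_cvg g f)).
  rewrite (_ : dot_psum g f = (fun X => (dot_psum f g X)^*)).
    apply: (@cvg_comp _ _ _ (dot_psum f g) (@conjc R) _ (nbhs (l2_dot f g))).
      exact: dot_psum_cvg.
    exact: conjc_continuous.
  apply/funext => X; rewrite /dot_psum /partial_sum rmorph_sum.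
  apply: eq_bigr => x _.
  case: (f _) => a b; case: (g _) => c d; move: (_%:num) => e /=.
  by congr (_ +i* _); ring.
- apply: (cvg_unique hs (@dot_psum_cvg f f)).
  rewrite (_ : dot_psum f f = (fun X => (mass f X)%:C)); first exact: mass_cvg.
  apply/funext => X; rewrite /dot_psum /partial_sum /mass rmorph_sum.
  rewrite [RHS](big_seq_fsetE _ X predT).
  apply: eq_bigr => x _; rewrite rmorphM /= -sqr_normc.
  by rewrite rmorphXn.
Qed.

(** The pointwise limit works, and the bounds on finite sums of |u i - u j|^2
    pass to the limit in j before the set of vertices grows. *)
Lemma l2_complete : cauchy_complete (l2 m).
Proof.
move=> u uC.
have pt x (h : l2 m) (e : R) : 0 <= e -> nm h <= Num.sqrt (m x)%:num * e ->
    normc (h x) <= e.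
  move=> e0 he; have := l2_pt x (l2P h); rewrite -nm_l2.
  have s0 : 0 < Num.sqrt (m x)%:num by rewrite sqrtr_gt0.
  rewrite -{1}(sqr_sqrtr (ltW (gt0 (m x)))) -exprMn.
  rewrite ler_pXn2r ?nnegrE ?nm_ge0 ?mulr_ge0 ?normc_ge0 ?(ltW s0)// => h1.
  by rewrite -(ler_pM2l s0) (le_trans h1).
have ptC (p : R[i] -> R) x : (forall z w, p (z - w) = p z - p w) ->
    (forall z, `|p z| <= normc z) -> cvg (p (u n x) @[n --> \oo]).
  move=> pB pn; apply: cauchy_cvg; apply: cauchy_exP => e e0.
  have s0 : 0 < Num.sqrt (m x)%:num by rewrite sqrtr_gt0.
  have e20 : 0 < e / 2 by rewrite divr_gt0.
  have [N hN] := uC _ (mulr_gt0 s0 e20).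
  exists (p (u N x)); exists N => // n /= Nn.
  rewrite /ball/= -pB (le_lt_trans (pn _))//.
  apply: (@le_lt_trans _ _ (e / 2)); last first.
    by rewrite ltr_pdivrMr// ltr_pMr// ltr1n.
  have := hN N n (leqnn _) Nn; exact: (pt x (u N - u n)) (ltW e20).
have cRe x : complex.Re (u n x) @[n --> \oo] -->
    lim (complex.Re (u n x) @[n --> \oo]).
  apply: (ptC (@complex.Re R)) => [z w|z]; first by case: z; case: w.
  by have [] := parts_le_normc z.
have cIm x : complex.Im (u n x) @[n --> \oo] -->
    lim (complex.Im (u n x) @[n --> \oo]).
  apply: (ptC (@complex.Im R)) => [z w|z]; first by case: z; case: w.
  by have [] := parts_le_normc z.
pose g x : R[i] := lim (complex.Re (u n x) @[n --> \oo]) +i*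
  lim (complex.Im (u n x) @[n --> \oo]).
have key e N i : 0 < e -> (N <= i)%N ->
    (forall i j, (N <= i)%N -> (N <= j)%N -> nm (u i - u j) <= e) ->
    (l2_fun (u i) - g) \in l2_pred m /\ l2_norm m (l2_fun (u i) - g) <= e.
  move=> e0 Ni hN; apply: mass_le_l2; first exact: ltW.
  move=> X.
  apply: (@cvgr_to_le _ \oo _ _ (fun j => mass (l2_fun (u i - u j)) X)).
    rewrite /mass; apply: cvg_big => [|x _]; first exact: add_continuous.
    apply: cvgMr.
    have nE (z : R[i]) : normc z ^+ 2 = complex.Re z * complex.Re z +
        complex.Im z * complex.Im z.
      by case: z => a b; rewrite /= sqr_sqrtr ?addr_ge0 ?sqr_ge0// !expr2.
    rewrite nE (_ : (fun j => _) = (fun j =>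
      (complex.Re (u i x) - complex.Re (u j x)) *
      (complex.Re (u i x) - complex.Re (u j x)) +
      (complex.Im (u i x) - complex.Im (u j x)) *
      (complex.Im (u i x) - complex.Im (u j x)))); last first.
      apply/funext => j; rewrite nE -[l2_fun (u i - u j) x]/(u i x - u j x).
      by rewrite cReD cImD; case: (l2_fun (u j) x).
    have h1 : complex.Re (u i x) - complex.Re (u j x) @[j --> \oo] -->
        complex.Re ((l2_fun (u i) - g) x).
      have -> : complex.Re ((l2_fun (u i) - g) x) =
          complex.Re (u i x) - complex.Re (g x).
        rewrite -[(l2_fun (u i) - g) x]/(u i x - g x).
        by case: (l2_fun (u i) x).
      by apply: cvgB; [exact: cvg_cst|exact: cRe].
    have h2 : complex.Im (u i x) - complex.Im (u j x) @[j --> \oo] -->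
        complex.Im ((l2_fun (u i) - g) x).
      have -> : complex.Im ((l2_fun (u i) - g) x) =
          complex.Im (u i x) - complex.Im (g x).
        rewrite -[(l2_fun (u i) - g) x]/(u i x - g x).
        by case: (l2_fun (u i) x).
      by apply: cvgB; [exact: cvg_cst|exact: cIm].
    by apply: cvgD; apply: cvgM.
  exists N => // j /= Nj; apply: (le_trans (mass_le (u i - u j) X)).
  by rewrite ler_pXn2r ?nnegrE ?nm_ge0 ?(ltW e0)//; exact: hN.
have gP : g \in l2_pred m.
  have [N hN] := uC 1 ltr01; have [h _] := key 1 N N ltr01 (leqnn _) hN.
  by rewrite -[g](subKr (l2_fun (u N))) rpredB// l2P.
apply/cvg_ex; exists (L2 gP); apply/cvg_nmP => e e0.
have [N hN] := uC _ e0; exists N => // i /= Ni; rewrite nm_distC.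
by have [_] := key e N i e0 Ni hN.
Qed.

Lemma finite_support_dense :
  dense_set [set f : l2 m | finite_set [set x | f x != 0]].
Proof.
move=> f e e0; have e20 : 0 < e ^+ 2 by rewrite exprn_gt0.
have [X hX] := mass_approx f e20.
pose g x : R[i] := if x \in X then f x else 0.
have massE Y : (X `<=` Y)%fset -> mass (l2_fun f - g) Y = mass f Y - mass f X.
  move=> XY; have -> : mass f X = \sum_(x <- Y)
      (if x \in X then (m x)%:num * normc (f x) ^+ 2 else 0).
    rewrite -(big_fset_incl _ XY); last by move=> x _ /negPf ->.
    by apply: eq_big_seq => x ->.
  rewrite /mass -sumrB; apply: eq_bigr => x _.
  rewrite -[(l2_fun f - g) x]/(f x - g x) /g.
  case: ifP => _; last by rewrite !subr0.
  rewrite !subrr (ComplexField.Normc.normc0 R : normc 0 = 0) expr0n/=.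
  by rewrite mulr0.
have [fgP fge] : (l2_fun f - g) \in l2_pred m /\ l2_norm m (l2_fun f - g) <= e.
  apply: mass_le_l2; first exact: ltW.
  move=> Y; apply: le_trans (mass_mono _ (fsubsetUl Y X)) _.
  rewrite massE ?fsubsetUr//; have := mass_le f (Y `|` X)%fset; lra.
have gP : g \in l2_pred m.
  by rewrite -[g](subKr (l2_fun f)) rpredB// l2P.
exists (L2 gP) => //=.
apply: (@sub_finite_set _ _ [set` X]) => // x /=.
by rewrite /g; case: ifP => //; rewrite eqxx.
Qed.

End l2_sums.

(** * Sectorial operators and the Laplacian *)

(** The numerical range only sees unit vectors; the rest is homogeneity. *)
Lemma numerical_sector (R : realType) (H : normedModType R[i])
    (dot : H -> H -> R[i]) (A : set (H * H)) (a tau : R) :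
  inner_product dot ->
  (forall c f y, op_addC A (- a%:C) (f, y) ->
     op_addC A (- a%:C) (c *: f, c *: y)) ->
  (forall f y, A (f, y) -> nm f = 1 ->
     `|complex.Im (dot y f)| <= tau * (complex.Re (dot y f) - a)) ->
  forall f y, op_addC A (- a%:C) (f, y) ->
    `|complex.Im (dot y f)| <= tau * complex.Re (dot y f).
Proof.
move=> dotP BZ WA f y fy; have [f0|f0] := eqVneq (nm f) 0.
  by rewrite (nm_eq0 f0) (dot_conj dotP) (dot0l dotP) /= oppr0 normr0 mulr0.
have nf0 : 0 < nm f by rewrite lt_def f0 nm_ge0.
pose c : R := (nm f)^-1; have c0 : 0 < c by rewrite invr_gt0.
have [[f' y'] Afy [/= e1 e2]] := BZ c%:C _ _ fy.
have cf1 : nm (c%:C *: f) = 1 by rewrite nmZR gtr0_norm// mulVf.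
rewrite e1 in Afy e2; have := WA _ _ Afy cf1.
have -> : y' = c%:C *: y + a%:C *: (c%:C *: f) by rewrite -e2 scaleNr subrK.
rewrite (dotDl dotP) (dotZl dotP a%:C) (dot_nm dotP) cf1 expr1n mulr1.
rewrite (dotZl dotP) (dotZr dotP) !(cReD, cImD, cReM, cImM, cReC, cImC) /=.
rewrite oppr0 !mul0r !subr0 !addr0 addrK => h.
have cc : 0 < c * c by rewrite mulr_gt0.
move: h; rewrite !mulrA normrM (gtr0_norm cc).
by rewrite -(mulrA tau) (mulrC tau) -(mulrA _ tau) ler_pM2l.
Qed.

Lemma m_sectorial_generates (R : realType) (V : countType)
    (m : V -> {posnum R}) (A : set (l2 m * l2 m)) (theta a : R) :
  0 <= theta < pi / 2 -> dense_set [set f | exists y, A (f, y)] ->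
  m_sectorial A theta a ->
  generates_holomorphic_semigroup (op_opp A) (pi / 2 - theta).
Proof.
move=> theta_range Ad [WA [Bacc Bres _]].
have dotP := l2_inner_product m.
have BR (l : R[i]) : 0 < complex.Re l ->
    exists Q : {linear l2 m -> l2 m},
      op_inverse (op_addC (op_addC A (- a%:C)) l) Q.
  move=> l0; have [|Q [_ QP]] := Bres (- l).
    by move: l0; case: (l) => x y /=; rewrite oppr_lt0.
  by exists Q; rewrite opprK in QP.
apply: (@sectorial_generates _ _ _ dotP (@l2_complete R V m) A a theta
  theta_range Ad) => //.
apply: numerical_sector => // [c f y fy|f y fy f1].
  have [Q QP] := BR 1 ltr01.
  have := @op_inverse_linear _ _ _ _ _ (c - 1) _ _ _ _ QP fy fy.
  by rewrite !scalerBl !scale1r !subrK.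
have [] // : sector_region a theta (l2_dot y f).
by apply: WA; exists (f, y) => //; split=> //=; rewrite nmE f1.
Qed.

Unset Implicit Arguments.

Theorem theorem5p1p4 (R : realType) (V : countType)
    (m : V -> {posnum R}) (b : V -> V -> R)
    (V_infinite : infinite_set [set: V])
    (b_ge0 : forall x y, 0 <= b x y)
    (b_loopless : forall x, b x x = 0)
    (b_locally_finite : locally_finite b)
    (b_weakly_connected : weakly_connected b)
    (b_out_gt0 : forall x, 0 < \sum_(y \in [set: V]) b x y)
    (b_kirchhoff : kirchhoff b)
    (theta a : R) (theta_range : 0 <= theta < pi / 2)
    (sectorial : m_sectorial (closure (laplacian m b)) theta a) :
  generates_holomorphic_semigroup
    (op_opp (closure (laplacian m b))) (pi / 2 - theta).
Proof.
apply: (@m_sectorial_generates R V m _ theta a) => // f e e0.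
have [g gfin fg] := finite_support_dense f e0; exists g => //.
have [u [v [ug uv]]] := laplacian_dom m b_ge0 b_locally_finite gfin.
exists v; apply: subset_closure; rewrite (_ : g = u)//.
exact/val_inj/esym.
Qed.
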